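(* Let $U=\{(\lambda_1,\lambda_2)\in[0,1]\times[0,1] : \lambda_1\ge\lambda_2,\ 0\le\lambda_1+\lambda_2\le1\}$. A (rooted) random Motzkin path is central and ergodic if and only if it is equal (in law) to $M^{(\lambda_1,\lambda_2)}$ for some $(\lambda_1,\lambda_2)\in U$. In particular, every central random Motzkin path $M$ with law $\nu_M$ is a mixing of the Markov chains $M^{(\lambda_1,\lambda_2)}$, $(\lambda_1,\lambda_2)\in U$; that is, there is a probability measure $\mu$ on $U$ such that $$\nu_M=\int_U\nu_{(\lambda_1,\lambda_2)}\,d\mu(\lambda_1,\lambda_2),$$ where $\nu_{(\lambda_1,\lambda_2)}$ denotes the law of $M^{(\lambda_1,\lambda_2)}$.
   Context: A (rooted, infinite) Motzkin path is an infinite lattice path in $\mathbb{N}\times\mathbb{N}$ ($0\in\mathbb{N}$) starting at $(0,0)$ and taking only steps $(1,1)$, $(1,0)$ and $(1,-1)$. A rooted random Motzkin path is a probability measure (equivalently a random path with that law) on the space of infinite rooted Motzkin paths with the $\sigma$-algebra generated by cylinder sets. It is central if, for every point $(n,d)$, conditionally on passing through $(n,d)$ its initial segment is uniformly distributed on the set of Motzkin paths from $(0,0)$ to $(n,d)$. It is ergodic if every measurable set of paths invariant under the tail relation (two paths are equivalent if they differ in finitely many steps) has probability $0$ or $1$. Let $m_{n,d}$ be the number of Motzkin paths from $(0,0)$ to $(n,d)$. For a central measure $\nu$ put $v_{n,d}=\nu(\omega_n=(n,d))$. A central measure is Markov with transition probabilities $\frac{v_{n+1,d'}}{m_{n+1,d'}}\cdot\frac{m_{n,d}}{v_{n,d}}$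 from $(n,d)$ to $(n+1,d')$, $|d-d'|\le1$, and it is uniquely determined by the values $v_{n,0}$, $n\ge0$, and the recursive rules $$\frac{m_{n-1,0}}{m_{n,1}}\,v_{n,1}=v_{n-1,0}-\frac{m_{n-1,0}}{m_{n,0}}\,v_{n,0},$$ $$\frac{m_{n-1,d}}{m_{n,d+1}}\,v_{n,d+1}=v_{n-1,d}-m_{n-1,d}\left(\frac{v_{n,d-1}}{m_{n,d-1}}+\frac{v_{n,d}}{m_{n,d}}\right)\qquad(1\le d<n).$$ For $(\lambda_1,\lambda_2)\in U$, $M^{(\lambda_1,\lambda_2)}=(M^{(\lambda_1,\lambda_2)}_n)_{n\ge0}$ denotes the unique random Motzkin path that is Markov and whose transition probabilities are determined by $$v^{(\lambda_1,\lambda_2)}_{n,0}=\mathbb{P}\big(M^{(\lambda_1,\lambda_2)}_n=(n,0)\big)=\sum_{l=0}^{\lfloor n/2\rfloor}\frac{n!}{(n-2l)!\,(l+1)!\,l!}\,\lambda_1^l\lambda_2^l(1-\lambda_1-\lambda_2)^{n-2l}$$ and the recursion above.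
   Formalization: M^(λ1,λ2) does not exist for every point of U (e.g. not at (0,0)); so ''equal in law to M^(λ1,λ2)'' is read as satisfying its defining description, and in the mixture ν_(λ1,λ2) is required to be the law of M^(λ1,λ2) only for μ-almost every (λ1,λ2) in U. *)

(* Defs.v *)
From HB Require Import structures.
From mathcomp Require Import all_boot all_order all_algebra.
From mathcomp Require Import all_classical all_reals all_analysis.
From mathcomp Require Import measurable_realfun.

Set Implicit Arguments.
Unset Strict Implicit.
Unset Printing Implicit Defensive.

Import Order.TTheory GRing.Theory Num.Theory.
Import numFieldNormedType.Exports.

Local Open Scope classical_set_scope.
Local Open Scope ring_scope.

(* Heights [a], [b] at consecutive times: [|a - b| <= 1], without truncated
   subtraction. *)
Definition motzkin_step (a b : nat) : bool := ((a <= b.+1) && (b <= a.+1))%N.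

(* An infinite rooted Motzkin path is given by its height function: it visits
   the points [(n, w n)]. *)
Record motzkin_path := MotzkinPath {
  height :> nat -> nat;
  height_root : height 0%N = 0%N;
  height_step : forall n, motzkin_step (height n) (height n.+1) }.

HB.instance Definition _ := gen_eqMixin motzkin_path.
HB.instance Definition _ := gen_choiceMixin motzkin_path.
HB.instance Definition _ := isPointed.Build motzkin_path
  (@MotzkinPath (fun=> 0%N) erefl (fun=> isT)).

(* The Motzkin paths from (0,0) to (n,d); the height at time [i <= n] is at
   most [n], so finite functions into ['I_n.+1] represent all of them. *)
Definition motzkin_to (n d : nat) : {set {ffun 'I_n.+1 -> 'I_n.+1}} :=
  [set p : {ffun 'I_n.+1 -> 'I_n.+1} |
    [&& p ord0 == 0%N :> nat, p ord_max == d :> nat &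
      [forall i : 'I_n, motzkin_step (p (widen_ord (leqnSn n) i))
                                     (p (lift ord0 i))]]]%SET.

Definition motzkin_count (n d : nat) : nat := #|motzkin_to n d|.

Definition cylinder n (p : {ffun 'I_n.+1 -> 'I_n.+1}) : set motzkin_path :=
  [set w : motzkin_path | forall i : 'I_n.+1, w i = p i :> nat].

Definition motzkin_cylinders : set (set motzkin_path) :=
  [set A | exists n d (p : {ffun 'I_n.+1 -> 'I_n.+1}),
     p \in motzkin_to n d /\ A = cylinder p].

HB.instance Definition _ := @isMeasurable.Build
  (sigma_display motzkin_cylinders) motzkin_path <<s motzkin_cylinders >>
  (@sigma_algebra0 _ setT motzkin_cylinders)
  (@sigma_algebraC _ motzkin_cylinders)
  (@sigma_algebra_bigcup _ setT motzkin_cylinders).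

Definition passes (n d : nat) : set motzkin_path :=
  [set w : motzkin_path | w n = d].

(* Two paths are tail equivalent when their edges
   [(n, w n) -> (n.+1, w n.+1)] differ for finitely many [n], i.e. when they
   eventually visit the same points. *)
Definition tail_equiv (w w' : motzkin_path) : Prop :=
  exists N, forall n, (N <= n)%N -> w n = w' n.

Definition tail_invariant (A : set motzkin_path) : Prop :=
  forall w w', tail_equiv w w' -> A w -> A w'.

Section random_motzkin_path.
Context {R : realType}.
Implicit Type nu : probability motzkin_path R.

(* Conditional probability of [A] given [B], meaningful when [nu B > 0]. *)
Definition cprob nu (A B : set motzkin_path) : R :=
  fine (nu (A `&` B)) / fine (nu B).

Definition central nu : Prop :=
  forall n d, (0 < nu (passes n d))%E ->
  forall p, p \in motzkin_to n d ->
    cprob nu (cylinder p) (passes n d) = (motzkin_count n d)%:R^-1.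

Definition ergodic nu : Prop :=
  forall A : set motzkin_path, measurable A -> tail_invariant A ->
    nu A = 0%E \/ nu A = 1%E.

Definition markov nu : Prop :=
  forall n d d' (p : {ffun 'I_n.+1 -> 'I_n.+1}),
    p \in motzkin_to n d -> (0 < nu (cylinder p))%E ->
    cprob nu (passes n.+1 d') (cylinder p) =
    cprob nu (passes n.+1 d') (passes n d).

Local Notation m n d := ((motzkin_count n d)%:R : R).

Definition motzkin_transitions nu (v : nat -> nat -> R) : Prop :=
  forall n d d', motzkin_step d d' -> (0 < nu (passes n d))%E ->
    cprob nu (passes n.+1 d') (passes n d) =
    v n.+1 d' / m n.+1 d' * (m n d / v n d).

(* The recursive rules; they determine [v n d] for [d <= n] from the values
   [v n 0]. *)
Definition motzkin_recursion (v : nat -> nat -> R) : Prop :=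
  (forall n, (1 <= n)%N ->
     m n.-1 0 / m n 1 * v n 1%N = v n.-1 0%N - m n.-1 0 / m n 0 * v n 0%N) /\
  (forall n d, (1 <= d < n)%N ->
     m n.-1 d / m n d.+1 * v n d.+1 =
     v n.-1 d - m n.-1 d * (v n d.-1 / m n d.-1 + v n d / m n d)).

Definition axis_prob (l : R * R) (n : nat) : R :=
  \sum_(k < n./2.+1)
    (n`!)%:R / ((n - 2 * k)`! * (k.+1)`! * k`!)%:R
      * l.1 ^+ k * l.2 ^+ k * (1 - l.1 - l.2) ^+ (n - 2 * k).

(* [is_M l nu]: [nu] is the law of M^(l.1, l.2), that is, [nu] makes the path
   Markov with the transitions obtained from the prescribed values [v n 0],
   which are the probabilities of visiting [(n, 0)].  The definition does not
   assert that such a [nu] exists: there is none for [l = (0, 0)], where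
   [v n 0 = 1] for all [n] although the transition from (1,0) to (2,0) has
   probability 1/2. *)
Definition is_M (l : R * R) nu : Prop :=
  exists v : nat -> nat -> R,
    [/\ forall n, v n 0%N = axis_prob l n,
        motzkin_recursion v,
        forall n, fine (nu (passes n 0)) = v n 0%N,
        markov nu
      & motzkin_transitions nu v].

Definition param_set : set (measurableTypeR R * measurableTypeR R) :=
  [set l | [/\ 0 <= l.1 <= 1, 0 <= l.2 <= 1, l.2 <= l.1
             & 0 <= l.1 + l.2 <= 1]].

(* [nu] is the mixture of the laws of the M^l with mixing measure [mu] carried
   by [param_set]; the integrand only matters up to a [mu]-null set. *)
Definition is_M_mixture
    (mu : probability (measurableTypeR R * measurableTypeR R)%type R) nu :
    Prop :=
  exists nu_ : measurableTypeR R * measurableTypeR R ->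
               probability motzkin_path R,
    [/\ {ae mu, forall l, param_set l -> is_M l (nu_ l)},
        forall A : set motzkin_path, measurable A ->
          measurable_fun param_set (fun l => nu_ l A)
      & forall A : set motzkin_path, measurable A ->
          nu A = (\int[mu]_(l in param_set) nu_ l A)%E].

End random_motzkin_path.

(* Main.v *)
Require Import Defs.
From HB Require Import structures.
From mathcomp Require Import all_boot all_order all_algebra.
From mathcomp Require Import all_classical all_reals all_analysis.
From mathcomp Require Import measurable_realfun.
From mathcomp Require Import zify ring lra.

Set Implicit Arguments.
Unset Strict Implicit.
Unset Printing Implicit Defensive.

Import Order.TTheory GRing.Theory Num.Theory.
Import numFieldNormedType.Exports.

Local Open Scope classical_set_scope.
Local Open Scope ring_scope.

(** Why the theorem is true.

    A central measure is described by phi(n, d), the probability of any one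
    path from (0, 0) to (n, d).  Additivity makes phi harmonic:
    phi(n, d) = phi(n+1, d-1) + phi(n+1, d) + phi(n+1, d+1), without the first
    term on the axis.  Solved for its last term this is the recursion for
    v(n, d) = m(n, d) phi(n, d), so phi is determined by c_n = phi(n, 0).

    The key fact is that flat steps are exchangeable.  Summing over a free
    step leaves phi unchanged by harmonicity, and imposing a flat step only
    advances the time, so the steps in a finite set I are all flat with
    probability c_|I| ([measure_flat_on]).  As in de Finetti's theorem the
    frequency of flat steps converges almost surely, to a tail-invariant
    limit T with values in [0, 1] and moments E[T^n] = c_n ([ae_cvg_freq],
    [integral_flat_freqX]).  This random variable classifies central measures:
    conditionally on T = t the density has axis values t^n.

    If the measure is ergodic, T is a constant t and phi is the harmonic
    function phi_t with axis values t^n ([ergodic_power_density]).  Positivity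
    of phi_t forces 3t <= 1 ([power_density_ge0_le]), which is exactly the
    condition for l1 + l2 = 1 - t and l1 l2 = t^2 to have a solution in U.  For
    such (l1, l2) a closed form of the path counts identifies the prescribed
    axis probabilities with m(n, 0) t^n ([axis_prob_diag]).

    Conversely let a Markov chain have the prescribed axis probabilities and
    transitions.  Its path probabilities telescope to phi, hence it is central;
    E[(T - s)^2] >= 0 and E[T (T - s)^2] >= 0, read on c_0, ..., c_3, force
    l1 l2 = (1 - l1 - l2)^2 ([is_M_product]), so that c_n = t^n with
    t = 1 - l1 - l2.  In particular only the points of U on this curve are
    parameters of a chain.  Then T has variance zero.  If A is a tail event, the
    restriction of the measure to A inherits the equality of the probabilities
    of paths with a common end, because exchanging prefixes preserves both the
    measure and A ([end_determined_tail]); as T = t on A too, the restriction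
    is proportional to the whole measure, and nu(A)^2 = nu(A)
    ([power_density_ergodic]).

    For the mixture, restricting to the tail event phi_T(n, d) < 0 shows that
    phi_T >= 0 almost surely ([flat_freq_admissible]).  A chain with density
    phi_t is built for every t with phi_t >= 0 by cutting the unit interval
    into nested intervals ([exists_cyl_density]), and mu is the law of the
    point of U attached to T ([central_mixture]). *)

(** * Paths, prefixes and their number *)

Lemma height_le (w : motzkin_path) n : (w n <= n)%N.
Proof.
elim: n => [|n IHn]; first by rewrite height_root.
by have /andP[_ h] := height_step w n; exact: leq_trans h _.
Qed.

(** Cylinders indexed by infinite paths: prefixes can then be extended, cut and
    glued without casts between the ordinals bounding their length. *)
Definition prefix_cyl (n : nat) (w : motzkin_path) : set motzkin_path :=
  [set w' | forall i, (i <= n)%N -> w' i = w i].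

Lemma level_path_step d n : motzkin_step (minn n d) (minn n.+1 d).
Proof. by rewrite /motzkin_step; lia. Qed.

(** A path through (n, d) for every n >= d. *)
Definition level_path d : motzkin_path :=
  MotzkinPath (height := fun i => minn i d) (min0n d) (level_path_step d).

Lemma turn_subproof (w : motzkin_path) n d (h : motzkin_step (w n) d) i :
  motzkin_step (if (i <= n)%N then w i else d)
               (if (i.+1 <= n)%N then w i.+1 else d).
Proof.
have [ltin|ltni] := ltnP i n; first by rewrite (ltnW ltin) height_step.
have [lein|ltni'] := leqP i n; last by rewrite /motzkin_step leqnSn.
by have -> : i = n by apply/eqP; rewrite eqn_leq lein ltni.
Qed.

Definition turn (w : motzkin_path) n d (h : motzkin_step (w n) d) :
    motzkin_path :=
  MotzkinPath (height := fun i => if (i <= n)%N then w i else d)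
    (height_root w) (turn_subproof h).

Lemma turn_prefix (w : motzkin_path) n d (h : motzkin_step (w n) d) :
  prefix_cyl n w (turn h).
Proof. by move=> i /= ->. Qed.

Lemma turn_last (w : motzkin_path) n d (h : motzkin_step (w n) d) : turn h n.+1 = d.
Proof. by rewrite /= ltnn. Qed.

Lemma splice_subproof (w0 w : motzkin_path) n (h : w n = w0 n) i :
  motzkin_step (if (i <= n)%N then w0 i else w i)
               (if (i.+1 <= n)%N then w0 i.+1 else w i.+1).
Proof.
have [ltin|ltni] := ltnP i n; first by rewrite (ltnW ltin) height_step.
have [lein|ltni'] := leqP i n; last exact: height_step.
have -> : i = n by apply/eqP; rewrite eqn_leq lein ltni.
by rewrite -h height_step.
Qed.

Definition splice (w0 w : motzkin_path) n (h : w n = w0 n) : motzkin_path :=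
  MotzkinPath (height := fun i => if (i <= n)%N then w0 i else w i)
    (height_root w0) (splice_subproof h).

(** The finite path represented by the first n steps of w; [inord] never
    truncates because a path satisfies w i <= i. *)
Definition history (n : nat) (w : nat -> nat) : {ffun 'I_n.+1 -> 'I_n.+1} :=
  [ffun i : 'I_n.+1 => inord (w i)].

Lemma historyE n (w : motzkin_path) (i : 'I_n.+1) : history n w i = w i :> nat.
Proof.
rewrite ffunE inordK // ltnS; exact: leq_trans (height_le w i) (ltn_ord i).
Qed.

Lemma eq_history n (w w' : motzkin_path) :
  history n w = history n w' <-> prefix_cyl n w w'.
Proof.
split=> [eqww' i lein|eqww'].
  pose o := Ordinal (lein : (i < n.+1)%N).
  by rewrite -[LHS](historyE w' o) -eqww' historyE.
apply/ffunP => i; apply: ord_inj; rewrite !historyE eqww' //.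
by rewrite -ltnS.
Qed.

Lemma history_motzkin n (w : motzkin_path) : history n w \in motzkin_to n (w n).
Proof.
rewrite inE !historyE /= height_root !eqxx /=; apply/forallP => i.
by rewrite !historyE /= height_step.
Qed.

(** A finite path is the prefix of the infinite path that stays at the last
    height. *)
Lemma motzkin_toP n d p :
  reflect (exists2 w : motzkin_path, p = history n w & w n = d)
          (p \in motzkin_to n d).
Proof.
apply: (iffP idP) => [|[w -> <-]]; last exact: history_motzkin.
rewrite inE => /and3P[/eqP p0 /eqP pn /forallP pstep].
have st i : motzkin_step (p (inord (minn i n))) (p (inord (minn i.+1 n))).
  have [ltin|leni] := ltnP i n.
    rewrite (minn_idPl ltin).
    have := pstep (Ordinal ltin).
    congr (motzkin_step (p _) (p _)); apply: val_inj => /=;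
      by rewrite inordK // /bump; lia.
  rewrite (minn_idPr (leqW leni)).
  by rewrite /motzkin_step leqnSn.
have h0 : p (inord (minn 0 n)) = 0%N :> nat.
  by rewrite min0n -p0; congr (val (p _)); apply: val_inj; rewrite /= inordK.
exists (MotzkinPath (height := fun i => p (inord (minn i n))) h0 st).
  apply/ffunP => i; apply: ord_inj; rewrite historyE /=.
  by rewrite (minn_idPl _) ?inord_val // -ltnS.
rewrite /= minnn -pn; congr (val (p _)); apply: val_inj => /=.
by rewrite inordK.
Qed.

Lemma cylinder_history n (w : motzkin_path) : cylinder (history n w) = prefix_cyl n w.
Proof.
apply/seteqP; split => w' h i.
  by move=> lein; rewrite (h (Ordinal (lein : (i < n.+1)%N))) historyE.
by rewrite historyE h // -ltnS.
Qed.

(** Erasing the last step is a bijection from the paths to (n.+1, d) with height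
    a at time n onto the paths to (n, a). *)
Lemma motzkin_count_split n d :
  motzkin_count n.+1 d =
    (\sum_(a < n.+1 | motzkin_step a d) motzkin_count n a)%N.
Proof.
pose r (p : {ffun 'I_n.+2 -> 'I_n.+2}) : {ffun 'I_n.+1 -> 'I_n.+1} :=
  history n (fun i => p (inord i)).
have rhistory (w : motzkin_path) : r (history n.+1 w) = history n w.
  apply/ffunP => i; rewrite ffunE historyE [RHS]ffunE inordK //.
  exact: ltn_trans (ltn_ord i) _.
rewrite /motzkin_count -sum1_card.
rewrite (partition_big (fun p : {ffun 'I_n.+2 -> 'I_n.+2} => r p ord_max)
   (fun a : 'I_n.+1 => motzkin_step a d)) /=; last first.
  move=> p /motzkin_toP[w -> <-]; rewrite rhistory historyE; exact: height_step.
apply: eq_bigr => a sta; rewrite -sum1_card.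
rewrite [RHS](_ : _ = \sum_(q in (r @:
   [set p in motzkin_to n.+1 d | r p ord_max == a]%SET)%SET) 1)%N.
  rewrite big_imset /=.
    by apply: eq_bigl => p; rewrite [RHS]finset.in_set.
  move=> p p'; rewrite finset.in_set => /andP[/motzkin_toP[w -> wd] _].
  rewrite finset.in_set => /andP[/motzkin_toP[w' -> wd'] _]; rewrite !rhistory.
  move=> /eq_history h; apply/eq_history => i; rewrite leq_eqVlt.
  by case/orP => [/eqP->|/h//]; rewrite wd wd'.
apply: eq_bigl => q; apply/idP/imsetP.
  move=> /motzkin_toP[w -> wa].
  have h : motzkin_step (w n) d by rewrite wa.
  exists (history n.+1 (turn h)); last first.
    by rewrite rhistory; apply/eq_history; exact: turn_prefix.
  rewrite finset.in_set; apply/andP; split.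
    by apply/motzkin_toP; exists (turn h); rewrite ?turn_last.
  by rewrite rhistory; apply/eqP/ord_inj; rewrite historyE /= leqnn.
case=> p; rewrite finset.in_set => /andP[/motzkin_toP[w -> wd]].
rewrite rhistory => /eqP ra ->; apply/motzkin_toP; exists w => //.
by rewrite -ra historyE.
Qed.

Lemma motzkin_count_gt n d : (n < d)%N -> motzkin_count n d = 0%N.
Proof.
move=> ltnd; apply: eq_card0 => p; apply/negP => /motzkin_toP[w _ wn].
by have := height_le w n; rewrite wn leqNgt ltnd.
Qed.

Lemma motzkin_count_gt0 n d : (d <= n)%N -> (0 < motzkin_count n d)%N.
Proof.
move=> ledn; apply/card_gt0P; exists (history n (level_path d)).
by apply/motzkin_toP; exists (level_path d) => //=; apply/minn_idPr.
Qed.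

Lemma motzkin_count0 d : motzkin_count 0 d = (d == 0)%N.
Proof.
case: d => [|d]; last by rewrite motzkin_count_gt.
apply/eqP; rewrite eqn_leq motzkin_count_gt0 // andbT.
by rewrite -[leqRHS](_ : #|{ffun 'I_1 -> 'I_1}| = 1%N) ?max_card// card_ffun !card_ord.
Qed.

Lemma motzkin_countS n d : motzkin_count n.+1 d =
  ((if d is d'.+1 then motzkin_count n d' else 0) + motzkin_count n d
   + motzkin_count n d.+1)%N.
Proof.
rewrite motzkin_count_split.
rewrite (big_ord_widen_cond (maxn n d).+3 (fun a => motzkin_step a d)
          (motzkin_count n)) /=; last by lia.

have -> : (\sum_(i < (maxn n d).+3 | motzkin_step i d && (i < n.+1)) motzkin_count n i
  = \sum_(i < (maxn n d).+3 | motzkin_step i d) motzkin_count n i)%N.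
  rewrite big_mkcondr; apply: eq_bigr => i _; case: ifPn => //.
  by rewrite -leqNgt => /motzkin_count_gt ->.
rewrite -(big_mkord (fun a => motzkin_step a d) (motzkin_count n)).
rewrite (@big_cat_nat _ _ _ d.-1) //=; last by lia.
rewrite (@big_cat_nat _ _ _ d.+2 d.-1) //=; [|by lia|by lia].
rewrite big_nat_cond big_pred0 ?add0n; last first.
  by move=> i; rewrite /motzkin_step; lia.
rewrite [X in (_ + X)%N]big_nat_cond [X in (_ + X)%N]big_pred0 ?addn0; last first.
  by move=> i; rewrite /motzkin_step; lia.
have st0 : motzkin_step d d by rewrite /motzkin_step; lia.
have st1 : motzkin_step d.+1 d by rewrite /motzkin_step; lia.
case: d st0 st1 => [|d] st0 st1 /=.
  by rewrite big_ltn_cond // st0 big_ltn_cond // st1 big_geq // addn0.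
have st2 : motzkin_step d d.+1 by rewrite /motzkin_step; lia.
rewrite big_ltn_cond //; last by lia.
rewrite st2 big_ltn_cond // st0 big_ltn_cond // st1 big_geq // addn0.
by rewrite addnA.
Qed.

(** * Closed form of the path counts *)

(** The contribution of the lower neighbour, absent on the axis. *)
Definition at_pred (V : nmodType) (f : nat -> V) (d : nat) : V :=
  if d is d'.+1 then f d' else 0.

Section explicit_count.
Context {R : realType}.

(** The ballot numbers: paths from (0, 0) to (n, d) with k down steps, k + d up
    steps and n - (2 k + d) flat steps. *)
Definition down_count (n d k : nat) : R :=
  if (2 * k + d <= n)%N then
    (n`!)%:R * d.+1%:R / (((n - (2 * k + d))`!)%:R * (k`!)%:R * ((k + d).+1`!)%:R)
  else 0.

Lemma down_count_eq0 n d k : (n < 2 * k + d)%N -> down_count n d k = 0.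
Proof. by move=> h; rewrite /down_count ifF //; lia. Qed.

(** With j flat steps at time n.+1, all four terms are multiples of
    X = n! / (j! k! (k + d + 1)!), and the identity reduces to
    (n + 1)(d + 1) = d (k + d + 1) + j (d + 1) + (d + 2) k for n + 1 = j + 2 k + d. *)
Lemma down_countS n d k :
  down_count n.+1 d k = at_pred (down_count n ^~ k) d
    + down_count n d k + at_pred (down_count n d.+1) k.
Proof.
have [le_n|gt_n] := leqP (2 * k + d) n.+1; last first.
  rewrite /down_count; rewrite !ifF; [|by lia|by lia].
  by case: d k gt_n => [|d] [|k] gt_n; rewrite /= ?addr0 // ?ifF ?addr0 //; lia.
have fn0 i : (i`!)%:R != 0 :> R by rewrite pnatr_eq0 -lt0n fact_gt0.
have sn0 i : i.+1%:R != 0 :> R by rewrite pnatr_eq0.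
have factE i : (i.+1)`!%:R = i.+1%:R * i`!%:R :> R by rewrite factS natrM.
pose j := (n.+1 - (2 * k + d))%N.
have nE : n.+1%:R = j%:R + 2 * k%:R + d%:R :> R.
  by rewrite -natrM -!natrD; congr (_%:R); rewrite /j; lia.
pose X : R := (n`!)%:R / ((j`!)%:R * (k`!)%:R * ((k + d).+1`!)%:R).
have -> : down_count n.+1 d k = X * n.+1%:R * d.+1%:R.
  rewrite /down_count le_n -/j /X (factE n).
  move: (n`!)%:R ((k + d).+1`!)%:R => A B; ring.
have -> : at_pred (down_count n ^~ k) d = X * d%:R * (k%:R + d%:R + 1).
  rewrite /X; clear X.
  case: d @j le_n nE => [|d] j le_n nE; first by rewrite /= !(mulr0, mul0r).
  rewrite /= /down_count ifT; last by lia.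
  rewrite (_ : n - (2 * k + d) = j)%N; last by rewrite /j; lia.
  rewrite addnS (factE (k + d).+1) -natrD natr1 addnS.
  move: (fn0 j) (fn0 k) (fn0 (k + d).+1) (sn0 (k + d).+1).
  move: (n`!)%:R (j`!)%:R (k`!)%:R ((k + d).+1`!)%:R (k + d).+2%:R d.+1%:R.
  by move=> A B C D E F B0 C0 D0 E0; field; rewrite B0 C0 D0 E0.
have -> : at_pred (down_count n d.+1) k = X * (d%:R + 2) * k%:R.
  rewrite /X; clear X.
  case: k @j le_n nE => [|k] j le_n nE; first by rewrite /= !(mulr0, mul0r).
  rewrite /= /down_count ifT; last by lia.
  rewrite (_ : n - (2 * k + d.+1) = j)%N; last by rewrite /j; lia.
  rewrite addSn addnS (factE k) -natrD addn2.
  move: (fn0 j) (fn0 k) (fn0 (k + d).+2) (sn0 k).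
  move: (n`!)%:R (j`!)%:R (k`!)%:R ((k + d).+2`!)%:R (k.+1)%:R d.+2%:R.
  by move=> A B C D E F B0 C0 D0 E0; field; rewrite B0 C0 D0 E0.
have -> : down_count n d k = X * j%:R * d.+1%:R.
  rewrite /down_count; have [le_n'|gt_n'] := leqP (2 * k + d) n; last first.
    by rewrite (_ : j = 0%N) ?mulr0 ?mul0r // /j; lia.
  have jE : j = (n - (2 * k + d)).+1 by rewrite /j; lia.
  rewrite /X jE (factE (n - (2 * k + d))%N).
  move: (fn0 (n - (2 * k + d))%N) (fn0 k) (fn0 (k + d).+1) (sn0 (n - (2 * k + d))%N).
  move: (n`!)%:R ((n - (2 * k + d))`!)%:R (k`!)%:R ((k + d).+1`!)%:R.
  move: d.+1%:R (n - (2 * k + d)).+1%:R.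
  by move=> A B C D E F B0 C0 D0 E0; field; rewrite B0 C0 D0 E0.
rewrite nE -natr1; ring.
Qed.

Lemma motzkin_countE n d :
  (motzkin_count n d)%:R = \sum_(k < n.+1) down_count n d k.
Proof.
elim: n d => [|n IHn] d.
  rewrite big_ord1 motzkin_count0 /down_count.
  case: d => [|d] //=.
  by rewrite /factorial /= !mulr1 invr1 mulr1.
rewrite motzkin_countS !natrD.
under [RHS]eq_bigr do rewrite down_countS.
rewrite 2!big_split /=; congr (_ + _ + _).
- case: d => [|d]; first by rewrite big1.
  by rewrite IHn [RHS]big_ord_recr /= down_count_eq0 ?addr0 //; lia.
- by rewrite IHn [RHS]big_ord_recr /= down_count_eq0 ?addr0 //; lia.
- by rewrite IHn [RHS]big_ord_recl add0r.
Qed.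

(** When l1 l2 = t^2 all paths of length n back to the axis have the same weight
    t^n, so the sum over the number of up steps only counts them. *)
Lemma axis_prob_diag (l : R * R) n (t := 1 - l.1 - l.2) :
  l.1 * l.2 = t ^+ 2 -> axis_prob l n = (motzkin_count n 0)%:R * t ^+ n.
Proof.
move=> lt; rewrite motzkin_countE mulr_suml.
rewrite /axis_prob (big_ord_widen n.+1 (fun k => (n`!)%:R /
  ((n - 2 * k)`! * (k.+1)`! * k`!)%:R * l.1 ^+ k * l.2 ^+ k *
  (1 - l.1 - l.2) ^+ (n - 2 * k))); last by lia.
rewrite big_mkcond; apply: eq_bigr => k _.
rewrite /down_count !addn0; case: ifPn => kn; last first.
  by rewrite ifF ?mul0r //; lia.
rewrite ifT; last by lia.
rewrite mulr1 -/t -2!mulrA; congr (_ / _ * _).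
  by rewrite mulnAC; rewrite (natrM _ (_ * _)) natrM.
by rewrite mulrA -exprMn lt -exprM -exprD; congr (_ ^+ _); lia.
Qed.

End explicit_count.

(** * Measures on the path space and exchangeability of flat steps *)

Lemma measurable_prefix_cyl n w : measurable (prefix_cyl n w).
Proof.
apply: sub_sigma_algebra; exists n, (w n), (history n w).
by rewrite cylinder_history history_motzkin.
Qed.

Lemma passes_bigcup n d :
  passes n d = \big[setU/set0]_(p in motzkin_to n d) cylinder p.
Proof.
rewrite -bigcup_seq_cond; apply/seteqP; split=> [w wn|w [p /= /andP[_ pn]]].
  exists (history n w); last by rewrite cylinder_history.
  by rewrite /= mem_index_enum /= -wn history_motzkin.
have /motzkin_toP[w' -> <-] := pn.
by rewrite cylinder_history => /(_ n (leqnn n)).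
Qed.

Lemma measurable_passes n d : measurable (passes n d).
Proof.
rewrite passes_bigcup; apply: bigsetU_measurable => p /motzkin_toP[w -> _].
by rewrite cylinder_history; exact: measurable_prefix_cyl.
Qed.

Lemma measurable_eq_height i j :
  measurable [set w : motzkin_path | w i = w j].
Proof.
rewrite (_ : [set w | _] = \bigcup_d (passes i d `&` passes j d)).
  apply: bigcupT_measurable => d.
  by apply: measurableI; exact: measurable_passes.
apply/seteqP; split=> [w /= ij|w [d _ []]]; first by exists (w j).
by rewrite /passes /= => -> ->.
Qed.

(** Two prefix cylinders are nested or disjoint, so together with the empty set
    they are closed under intersection and determine measures. *)
Definition cyl_or_empty : set (set motzkin_path) :=
  [set A | A = set0 \/ exists n w, A = prefix_cyl n w].

Lemma cyl_or_empty_sigma :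
  (@measurable _ motzkin_path) = <<s cyl_or_empty >>.
Proof.
apply/seteqP; split.
  apply: smallest_sub; first exact: smallest_sigma_algebra.
  move=> _ [n [d [p [/motzkin_toP[w -> _] ->]]]]; apply: sub_sigma_algebra.
  by right; exists n, w; rewrite cylinder_history.
apply: smallest_sub; first exact: smallest_sigma_algebra.
move=> A [->|[n [w ->]]]; first exact: sigma_algebra0.
exact: measurable_prefix_cyl.
Qed.

Lemma prefix_cyl_sub m n (w w' : motzkin_path) : (m <= n)%N ->
  prefix_cyl m w w' -> prefix_cyl n w' `<=` prefix_cyl m w.
Proof.
by move=> mn ww' u uw' i im; rewrite uw' ?ww' // (leq_trans im).
Qed.

Lemma prefix_cylI m n (w w' : motzkin_path) : (m <= n)%N ->
  prefix_cyl m w `&` prefix_cyl n w' =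
  if `[< prefix_cyl m w w' >] then prefix_cyl n w' else set0.
Proof.
move=> mn; case: asboolP => h; first exact/setIidr/prefix_cyl_sub.
apply/seteqP; split=> // u [uw uw']; apply: h => i im.
by rewrite -uw' ?uw // (leq_trans im).
Qed.

Lemma cyl_or_emptyI : setI_closed cyl_or_empty.
Proof.
move=> A B [->|[m [w ->]]]; first by rewrite set0I; left.
move=> [->|[n [w' ->]]]; first by rewrite setI0; left.
wlog mn : m n w w' / (m <= n)%N => [hwlog|].
  have /orP[mn|nm] := leq_total m n; first exact: hwlog.
  by rewrite setIC; exact: hwlog.
rewrite prefix_cylI //; case: ifP => _; last by left.
by right; exists n, w'.
Qed.

Lemma prefix_cyl0 w : prefix_cyl 0 w = setT.
Proof.
by apply/seteqP; split=> // u _ [|//] _; rewrite !height_root.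
Qed.

Lemma cylinder_induction (P : set (set motzkin_path)) :
  (forall n w, P (prefix_cyl n w)) -> P set0 ->
  (forall S, measurable S -> P S -> P (~` S)) ->
  (forall F : (set motzkin_path)^nat, (forall n, measurable (F n)) ->
    trivIset [set: nat] F -> (forall n, P (F n)) -> P (\bigcup_k F k)) ->
  forall S, measurable S -> P S.
Proof.
move=> Pcyl P0 PC PU S; rewrite cyl_or_empty_sigma.
apply: dynkin_induction => //.
- exact: cyl_or_empty_sigma.
- exact: cyl_or_emptyI.
- by rewrite -(prefix_cyl0 (level_path 0)).
- by move=> A [->|[n [w ->]]].
Qed.

Section measure_on_paths.
Context {R : realType}.

Lemma eq_measure_cyl (mu mu' : {measure set motzkin_path -> \bar R}) :
  (mu setT < +oo)%E ->
  (forall n w, mu (prefix_cyl n w) = mu' (prefix_cyl n w)) ->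
  forall A, measurable A -> mu A = mu' A.
Proof.
move=> fin eq_cyl A mA.
apply: (measure_unique cyl_or_empty (fun=> setT)) => //.
- exact: cyl_or_empty_sigma.
- exact: cyl_or_emptyI.
- by move=> _; right; exists 0%N, (level_path 0); rewrite prefix_cyl0.
- by rewrite bigcup_const.
- by move=> _ [->|[n [w ->]]]; rewrite ?measure0.
Qed.

Lemma measure_split_next (mu : {measure set motzkin_path -> \bar R}) n w B :
  measurable B ->
  mu (prefix_cyl n w `&` B) =
    (at_pred (fun d => mu (prefix_cyl n w `&` passes n.+1 d `&` B)) (w n)
     + mu (prefix_cyl n w `&` passes n.+1 (w n) `&` B)
     + mu (prefix_cyl n w `&` passes n.+1 (w n).+1 `&` B))%E.
Proof.
move=> mB.
pose E d := prefix_cyl n w `&` passes n.+1 d `&` B.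
have mE d : measurable (E d).
  apply: measurableI => //; apply: measurableI.
    exact: measurable_prefix_cyl.
  exact: measurable_passes.
have dE d d' : d != d' -> E d `&` E d' = set0.
  move=> /eqP dd'; apply/seteqP; split=> // u [[[_ ud] _] [[_ ud'] _]].
  by apply: dd'; rewrite -ud -ud'.
have EU : prefix_cyl n w `&` B =
    (if w n is d.+1 then E d else set0) `|` E (w n) `|` E (w n).+1.
  apply/seteqP; split=> u.
    move=> [uw Bu]; have := height_step u n; rewrite uw // /motzkin_step.
    case wn : (w n) => [|d] => /andP[h1 h2].
      have [|] : u n.+1 = 0%N \/ u n.+1 = 1%N by lia.
        by move=> un; left; right.
      by move=> un; right.
    have [|[|]] : u n.+1 = d \/ u n.+1 = d.+1 \/ u n.+1 = d.+2 by lia.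
    - by move=> un; left; left.
    - by move=> un; left; right.
    - by move=> un; right.
  by case: (w n) => [|d] [[//|]|] [[? ?] ?].
rewrite EU measureU //=; last 2 first.
- by case: (w n) => [|d]; apply: measurableU.
- rewrite setIUl dE ?setU0 //; last by lia.
  by case: (w n) => [|d]; rewrite ?set0I // dE //; lia.
congr (_ + _)%E; case: (w n) => [|d] /=; first by rewrite set0U add0e.
by rewrite measureU // dE //; lia.
Qed.

Lemma prefix_cylS (w : motzkin_path) n d (h : motzkin_step (w n) d) :
  prefix_cyl n.+1 (turn h) = prefix_cyl n w `&` passes n.+1 d.
Proof.
apply/seteqP; split=> [u hu|u [un ud] i].
  split; last by rewrite /passes /= hu // turn_last.
  by move=> i lein; rewrite hu ?leqW //= lein.
rewrite leq_eqVlt => /orP[/eqP ->|]; first by rewrite turn_last.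
by rewrite ltnS => lein; rewrite /= lein un.
Qed.

Definition cyl_density (mu : set motzkin_path -> \bar R) (phi : nat -> nat -> R) :=
  forall n (w : motzkin_path), mu (prefix_cyl n w) = (phi n (w n))%:E.

Definition path_harmonic (phi : nat -> nat -> R) := forall n d, (d <= n)%N ->
  phi n d = at_pred (phi n.+1) d + phi n.+1 d + phi n.+1 d.+1.

Lemma level_path_end n d : (d <= n)%N -> level_path d n = d.
Proof. by move=> dn /=; apply/minn_idPr. Qed.

Lemma motzkin_step_refl d : motzkin_step d d.
Proof. by rewrite /motzkin_step leqnSn. Qed.

Lemma motzkin_step_up d : motzkin_step d d.+1.
Proof. by rewrite /motzkin_step leqnn andbT; lia. Qed.

Lemma motzkin_step_down d : motzkin_step d.+1 d.
Proof. by rewrite /motzkin_step leqnn /=; lia. Qed.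

Definition flat_on k N (I : pred nat) : set motzkin_path :=
  [set w | forall i, (k <= i < k + N)%N -> I i -> w i.+1 = w i].

Lemma measurable_flat_on k N I : measurable (flat_on k N I).
Proof.
rewrite (_ : flat_on k N I = \bigcap_(i in [set i | (k <= i < k + N)%N && I i])
   [set w : motzkin_path | w i.+1 = w i]); last first.
  apply/seteqP; split=> w h i; first by move=> /= /andP[]; exact: h.
  by move=> ki Ii; apply: h; rewrite /= ki.
rewrite bigcap_mkcond; apply: bigcapT_measurable => i.
by case: ifP => // _; exact: measurable_eq_height.
Qed.

Section with_density.
Variables (mu : {measure set motzkin_path -> \bar R}) (phi : nat -> nat -> R).
Hypothesis mu_phi : cyl_density mu phi.

Lemma cyl_density_harmonic : path_harmonic phi.
Proof.
move=> n d dn.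
have wn := level_path_end dn; set w := level_path d in wn.
have := measure_split_next mu n w (@measurableT _ _).
rewrite !setIT mu_phi wn.
have h0 : motzkin_step (w n) d by rewrite wn motzkin_step_refl.
have h1 : motzkin_step (w n) d.+1 by rewrite wn motzkin_step_up.
rewrite -(prefix_cylS h0) -(prefix_cylS h1) !mu_phi !turn_last.
case: d dn w wn h0 h1 => [|d] dn w wn h0 h1 /=.
  by rewrite add0e add0r => -[].
have h2 : motzkin_step (w n) d by rewrite wn motzkin_step_down.
by rewrite setIT -(prefix_cylS h2) mu_phi turn_last => -[].
Qed.

(** Induction on the number N of steps to come.  A step in I has to be flat: it
    keeps the height and advances the time, which is what the counter records.
    A step outside I is free, and summing phi over its outcomes brings the time
    back by harmonicity. *)
Lemma cyl_flat_on k N I (w : motzkin_path) :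
  mu (prefix_cyl k w `&` flat_on k N I) =
  (phi (k + count I (iota k N)) (w k))%:E.
Proof.
elim: N k w => [|N IHN] k w.
  rewrite addn0 (_ : flat_on k 0 I = setT) ?setIT ?mu_phi //.
  by apply/seteqP; split=> // u _ i; lia.
have next d (h : motzkin_step (w k) d) : (I k -> d = w k) ->
    prefix_cyl k w `&` passes k.+1 d `&` flat_on k N.+1 I =
    prefix_cyl k.+1 (turn h) `&` flat_on k.+1 N I.
  move=> Ikd; rewrite prefix_cylS; apply/seteqP; split=> u [[uw ud] uf];
    split => // i ki Ii; first by apply: uf => //; lia.
  have [ik|ik] := eqVneq i k; last by apply: uf => //; lia.
  by rewrite ik in Ii *; rewrite ud (Ikd Ii) uw.
have h0 : motzkin_step (w k) (w k) by rewrite motzkin_step_refl.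
rewrite /=; case Ik : (I k); last first.
  have h1 : motzkin_step (w k) (w k).+1 by rewrite motzkin_step_up.
  rewrite measure_split_next; last exact: measurable_flat_on.
  rewrite (next _ h0) ?Ik // (next _ h1) ?Ik // !IHN !turn_last add0n.
  rewrite (@cyl_density_harmonic (k + _)); last first.
    by rewrite (leq_trans (height_le w k)) // leq_addr.
  rewrite !addSn !EFinD; congr (_ + _ + _)%E.
  case wk : (w k) h0 h1 => [|d] //= h0 h1.
  have h2 : motzkin_step (w k) d by rewrite wk motzkin_step_down.
  by rewrite (next _ h2) ?Ik // IHN turn_last addSn.
rewrite (_ : _ `&` _ = prefix_cyl k.+1 (turn h0) `&` flat_on k.+1 N I).
  by rewrite IHN turn_last addSnnS.
rewrite -next //; apply/seteqP; split=> u; last by move=> [[]].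
by move=> [uw uf]; split => //; split => //; rewrite /passes /= uf ?uw //; lia.
Qed.

(** Flat steps are exchangeable: only the number of prescribed steps matters. *)
Lemma measure_flat_on N I :
  mu (flat_on 0 N I) = (phi (count I (iota 0 N)) 0%N)%:E.
Proof.
have := cyl_flat_on 0 N I (level_path 0).
by rewrite prefix_cyl0 setTI add0n height_root.
Qed.

End with_density.

End measure_on_paths.

(** * The frequency of flat steps *)

Definition flats (N : nat) (w : motzkin_path) : nat :=
  (\sum_(i < N) (w i.+1 == w i))%N.

Lemma flats_le N w : (flats N w <= N)%N.
Proof.
rewrite -[leqRHS]card_ord -sum1_card; apply: leq_sum => i _; exact: leq_b1.
Qed.

Lemma count_mem_ord N (I : {set 'I_N}) :
  count [pred i | i \in map val (enum I)] (iota 0 N) = #|I|.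
Proof.
rewrite -val_enum_ord count_map (@eq_count _ _ (mem I)) => [|i]; last first.
  by rewrite /= mem_map ?mem_enum //; exact: val_inj.
by rewrite cardE -size_filter [in RHS]/enum_mem enumT.
Qed.

Lemma flat_on_set N (I : {set 'I_N}) w :
  flat_on 0 N [pred i | i \in map val (enum I)] w <->
  (I \subset [set i : 'I_N | w i.+1 == w i]%SET).
Proof.
split=> [h|/fintype.subsetP h].
  apply/fintype.subsetP => i iI; rewrite finset.in_set; apply/eqP; apply: h.
    by rewrite /= add0n.
  by rewrite inE /= map_f // mem_enum.
move=> i /= iN /mapP[j]; rewrite mem_enum => /h.
by rewrite finset.in_set => /eqP hj ->.
Qed.

Section flat_frequency.
Context {R : realType}.

(** The binomial coefficient counts the sets of n flat steps, each of which is an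
    event of known probability. *)
Lemma bin_flats N n w :
  ('C(flats N w, n)%:R)%:E = (\sum_(I : {set 'I_N} | #|I| == n)
    (\1_(flat_on 0 N [pred i | i \in map val (enum I)]) w)%:E)%E :> \bar R.
Proof.
have -> : flats N w = #|[set i : 'I_N | w i.+1 == w i]%SET|.
  rewrite /flats -sum1_card big_mkcond [in RHS]big_mkcond /=.
  by apply: eq_bigr => i _; rewrite finset.in_set; case: eqP.
rewrite -cards_draws -sum1_card natr_sum sumEFin; congr (_%:E).
rewrite big_mkcond [in RHS]big_mkcond; apply: eq_bigr => I _.
rewrite finset.in_set; case: (#|I| == n); rewrite ?andbT ?andbF // indicE.
case: ifPn => h; first by rewrite mem_set //; exact/flat_on_set.
by rewrite memNset // => /flat_on_set; exact/negP.
Qed.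

Definition freq (N : nat) (w : motzkin_path) : R := (flats N w)%:R / N%:R.

Lemma freq_ge0 N w : 0 <= freq N w.
Proof. by rewrite /freq divr_ge0. Qed.

Lemma freq_le1 N w : freq N w <= 1.
Proof.
rewrite /freq; have [->|N0] := eqVneq N 0%N; first by rewrite invr0 mulr0.
by rewrite ler_pdivrMr ?mul1r ?ltr0n ?lt0n // ler_nat flats_le.
Qed.

(** The limit superior is defined for every path and insensitive to finitely many
    steps.  Along the powers of 4 the variance of the increments is summable with
    room to spare, which gives almost sure convergence. *)
Definition flat_freq (w : motzkin_path) : R :=
  limn_sup (fun k => freq (4 ^ k) w : R^o).

Lemma measurable_indic_flat i :
  measurable_fun setT (\1_([set w : motzkin_path | w i.+1 = w i]) : _ -> R).
Proof. by apply: measurable_indic; exact: measurable_eq_height. Qed.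

Lemma natr_flats N w :
  (flats N w)%:R = \sum_(i < N) \1_([set w : motzkin_path | w i.+1 = w i]) w :> R.
Proof.
rewrite natr_sum; apply: eq_bigr => i _; rewrite indicE; congr (_%:R).
by case: eqP => h; [rewrite mem_set|rewrite memNset].
Qed.

Lemma measurable_flats N : measurable_fun setT (fun w => (flats N w)%:R : R).
Proof.
under eq_fun do rewrite natr_flats.
by apply: measurable_sum => i; exact: measurable_indic_flat.
Qed.

Lemma measurable_freq N : measurable_fun setT (freq N).
Proof. by apply: measurable_funM => //; exact: measurable_flats. Qed.

Lemma freq_bounded w : bounded_fun (fun k => freq (4 ^ k) w : R^o).
Proof.
exists 1; split=> // M M1 k _ /=.
by rewrite ger0_norm ?freq_ge0 // (le_trans (freq_le1 _ _)) // ltW.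
Qed.

Lemma measurable_flat_freq : measurable_fun setT flat_freq.
Proof.
apply: measurable_fun_limn_sup.
- by move=> w _; exact/bounded_fun_has_ubound/freq_bounded.
- by move=> w _; exact/bounded_fun_has_lbound/freq_bounded.
- by move=> k; exact: measurable_freq.
Qed.

Lemma flat_freq_itv w : 0 <= flat_freq w <= 1.
Proof.
rewrite /flat_freq limn_supE; last exact: freq_bounded.
have ub := bounded_fun_has_ubound (freq_bounded w).
apply/andP; split.
  apply: lb_le_inf; first by exists (sups (fun k => freq (4 ^ k) w) 0); exists 0%N.
  move=> _ [n _ <-]; apply: le_trans (freq_ge0 (4 ^ n) w) _.
  apply: ub_le_sup; last by exists n => /=.
  exact/has_ubound_sdrop.
apply: (@le_trans _ _ (sups (fun k => freq (4 ^ k) w) 0)).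
  apply: ge_inf; last by exists 0%N.
  exact/bounded_fun_has_lbound_sups/freq_bounded.
apply: ge_sup; first by exists (freq (4 ^ 0) w); exists 0%N.
by move=> _ [n _ <-]; exact: freq_le1.
Qed.

End flat_frequency.

(** * Low moments of the frequency *)

Section flat_moments.
Context {R : realType}.
Variables (mu : {measure set motzkin_path -> \bar R}) (phi : nat -> nat -> R).
Hypothesis mu_phi : cyl_density mu phi.

Lemma cyl_density_mass : mu setT = (phi 0 0)%:E.
Proof. by rewrite -(prefix_cyl0 (level_path 0)) mu_phi height_root. Qed.

Lemma cyl_density_fin : (mu setT < +oo)%E.
Proof. by rewrite cyl_density_mass ltry. Qed.

Lemma integral_bin_flats N n :
  (\int[mu]_w ('C(flats N w, n)%:R)%:E = ('C(N, n)%:R * phi n 0)%:E)%E.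
Proof.
under eq_integral do rewrite bin_flats -big_filter.
rewrite ge0_integral_sum //; last first.
  move=> I; apply/measurable_EFinP; apply: measurable_indic.
  exact: measurable_flat_on.
rewrite big_filter.
under eq_bigr => I /eqP In.
  rewrite integral_indic ?setIT //; last exact: measurable_flat_on.
  rewrite (measure_flat_on mu_phi) count_mem_ord In.
  over.
rewrite sumEFin sumr_const mulr_natl; congr (_ *+ _)%:E.
rewrite -[in RHS](card_ord N) -(card_draws 'I_N n).
by apply: eq_card => I; rewrite finset.in_set.
Qed.

Lemma integral_flatsM N M : (N <= M)%N ->
  (\int[mu]_w ((flats N w)%:R * (flats M w)%:R)%:E =
   (N%:R * (phi 1 0 + (M%:R - 1) * phi 2 0))%:E)%E.
Proof.
move=> NM.
under eq_integral => w _.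
  rewrite !natr_flats mulr_suml -sumEFin.
  under eq_bigr do rewrite mulr_sumr -sumEFin.
  over.
pose E i : set motzkin_path := [set w | w i.+1 = w i].
have mE i : measurable (E i) by exact: measurable_eq_height.
have mEE i j : measurable_fun setT
    (fun w => (\1_(E i) w * \1_(E j) w)%:E : \bar R).
  apply/measurable_EFinP.
  by apply: measurable_funM; exact: measurable_indic.
have EE0 i j w : (0 <= (\1_(E i) w * \1_(E j) w)%:E :> \bar R)%E.
  by rewrite lee_fin mulr_ge0.
have intEE i j : (i < M)%N -> (j < M)%N ->
    (\int[mu]_w (\1_(E i) w * \1_(E j) w)%:E =
     (if i == j then phi 1 0 else phi 2 0)%:E)%E.
  move=> iM jM.
  rewrite (eq_integral (fun w => (\1_(flat_on 0 M (pred2 i j)) w)%:E)).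
    rewrite integral_indic ?setIT //; last exact: measurable_flat_on.
    rewrite (measure_flat_on mu_phi).
    have [->|ij] := eqVneq i j.
      rewrite (@eq_count _ _ (pred1 j)); last by move=> k /=; rewrite orbb.
      by rewrite count_uniq_mem ?iota_uniq // mem_iota jM.
    have -> : count (pred2 i j) (iota 0 M) =
        (count_mem i (iota 0 M) + count_mem j (iota 0 M))%N.
      rewrite -count_predUI (@eq_count _ (predI _ _) pred0) ?count_pred0 ?addn0.
        exact: eq_count.
      by move=> k /=; apply/negP => /andP[/eqP -> /eqP]; exact/eqP.
    by rewrite !count_uniq_mem ?iota_uniq // !mem_iota iM jM.
  move=> w _; congr (_%:E); rewrite -[LHS]/((\1_(E i) \* \1_(E j)) w) -indicI.
  congr (\1_ _ w).
  apply/seteqP; split=> [u [ui uj] k _ /orP[] /eqP ->//|u h].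
  by split; apply: h => //=; rewrite ?add0n ?eqxx ?orbT.
rewrite ge0_integral_sum //; last 2 first.
- by move=> i; apply: emeasurable_sum => j; exact: mEE.
- by move=> i w _; apply: sume_ge0 => j _; exact: EE0.
rewrite (eq_bigr (fun i : 'I_N => (phi 1 0 + (M%:R - 1) * phi 2 0)%:E)).
  by rewrite sumEFin sumr_const card_ord mulr_natl.
move=> i _; rewrite ge0_integral_sum //; last by move=> j; exact: mEE.
have iM : (i < M)%N by exact: leq_trans (ltn_ord i) NM.
rewrite (eq_bigr (fun j : 'I_M => (if i == j :> nat then phi 1 0 else phi 2 0)%:E)).
  rewrite sumEFin (bigD1 (Ordinal iM)) //= eqxx; congr (_ + _)%:E.
  rewrite (eq_bigr (fun=> phi 2 0)) => [|j]; last first.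
    by rewrite -val_eqE /= eq_sym => /negPf ->.
  rewrite sumr_const (@eq_card _ _ (predC1 (Ordinal iM))) //.
  rewrite cardC1 card_ord -[LHS]mulr_natl; congr (_ * _); rewrite -subn1 natrB //.
  exact: leq_ltn_trans iM.
by move=> j _; rewrite intEE.
Qed.

Lemma integral_freqM N M : (0 < N)%N -> (N <= M)%N ->
  (\int[mu]_w (freq N w * freq M w)%:E =
   ((phi 1 0 - phi 2 0) / M%:R + phi 2 0)%:E)%E.
Proof.
move=> N0 NM; have M0 : (0 < M)%N by exact: leq_trans NM.
have N0' : N%:R != 0 :> R by rewrite pnatr_eq0 -lt0n.
have M0' : M%:R != 0 :> R by rewrite pnatr_eq0 -lt0n.
under eq_integral => w _.
  rewrite (_ : _ * _ = (N%:R * M%:R)^-1 * ((flats N w)%:R * (flats M w)%:R)); last first.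
    by rewrite /freq; field; rewrite N0' M0'.
  rewrite EFinM.
  over.
rewrite ge0_integralZl_EFin //.
- rewrite integral_flatsM // -EFinM; congr (_%:E); field.
  by rewrite N0' M0'.
- by apply/measurable_EFinP/measurable_funM; exact: measurable_flats.
Qed.

(** For an exchangeable sequence the averages over N and M terms are at distance
    O(1 / N) in the square mean. *)
Lemma integral_freqB N M : (0 < N)%N -> (N <= M)%N ->
  (\int[mu]_w ((freq M w - freq N w) ^+ 2)%:E =
   ((phi 1 0 - phi 2 0) * (N%:R^-1 - M%:R^-1))%:E)%E.
Proof.
move=> N0 NM.
have mf K L : measurable_fun setT (fun w => (freq K w * freq L w)%:E : \bar R).
  by apply/measurable_EFinP/measurable_funM; exact: measurable_freq.
have f0 K L w : (0 <= (freq K w * freq L w)%:E :> \bar R)%E.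
  by rewrite lee_fin mulr_ge0 // freq_ge0.
have : (\int[mu]_w (((freq M w - freq N w) ^+ 2)%:E
       + (2%:E * (freq N w * freq M w)%:E)) =
   \int[mu]_w ((freq M w * freq M w)%:E + (freq N w * freq N w)%:E))%E.
  by apply: eq_integral => w _; rewrite -EFinM -!EFinD; congr (_%:E); ring.
rewrite ge0_integralD //; last 4 first.
- by move=> w _; rewrite lee_fin sqr_ge0.
- apply/measurable_EFinP/measurable_funX/measurable_funB; exact: measurable_freq.
- by move=> w _; rewrite mule_ge0.
- by under eq_fun do rewrite muleC; apply: emeasurable_funM.
rewrite ge0_integralZl_EFin // [RHS]ge0_integralD //.
rewrite !integral_freqM // ?(leq_trans N0) // -EFinM -EFinD.
set c := (X in (_ + X%:E)%E = _).
move=> /(congr1 (fun y => y - c%:E)%E); rewrite addeK // => ->.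
by rewrite -EFinB /c; congr (_%:E); ring.
Qed.

End flat_moments.

(** * Almost sure convergence of the frequency *)

Section flat_moment_limit.
Context {R : realType}.

Lemma bin_ratio_recl (F N n : nat) : (n < N)%N ->
  'C(F, n.+1)%:R / 'C(N, n.+1)%:R =
  'C(F, n)%:R / 'C(N, n)%:R * ((F%:R - n%:R) / (N%:R - n%:R)) :> R.
Proof.
move=> nN.
have binS m : (n.+1)%:R * 'C(m, n.+1)%:R = (m%:R - n%:R) * 'C(m, n)%:R :> R.
  have [nm|mn] := leqP n m; last by rewrite !bin_small ?mulr0 //; lia.
  by rewrite -natrB // -!natrM mul_bin_left.
have n0 : n.+1%:R != 0 :> R by rewrite pnatr_eq0.
have Nn0 : N%:R - n%:R != 0 :> R by rewrite -natrB 1?ltnW // pnatr_eq0 subn_eq0 -ltnNge.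
have C0 : 'C(N, n)%:R != 0 :> R by rewrite pnatr_eq0 -lt0n bin_gt0 ltnW.
have binE m : 'C(m, n.+1)%:R = (m%:R - n%:R) * 'C(m, n)%:R / (n.+1)%:R :> R.
  by rewrite -binS mulrAC mulfV // mul1r.
by rewrite !binE; field; rewrite nat1r n0 Nn0 C0.
Qed.

Lemma cvg_nat_pow4 (n : nat) : (n%:R / (4 ^ k)%:R : R) @[k --> \oo] --> (0 : R).
Proof.
have : geometric (n%:R : R) (4^-1) @ \oo --> (0 : R).
  by apply: cvg_geometric; rewrite ger0_norm // invf_lt1 // ltr1n.
apply: cvg_trans; apply: near_eq_cvg; apply: nearW => k /=.
by rewrite natrX exprVn.
Qed.

(** The ratio is a product of n factors (F - i) / (N - i), each with the same
    limit as F / N. *)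
Lemma cvg_bin_ratio (F : nat -> nat) (t : R) n :
  (F k)%:R / (4 ^ k)%:R @[k --> \oo] --> t ->
  'C(F k, n)%:R / 'C(4 ^ k, n)%:R @[k --> \oo] --> t ^+ n.
Proof.
move=> Ft; elim: n => [|n IHn].
  rewrite expr0; apply: cvg_near_cst; apply: nearW => k.
  by rewrite !bin0 divr1.
rewrite exprSr.
have step : ((F k)%:R - n%:R) / ((4 ^ k)%:R - n%:R) @[k --> \oo] --> t.
  have : ((F k)%:R / (4 ^ k)%:R - n%:R / (4 ^ k)%:R) /
         (1 - n%:R / (4 ^ k)%:R) @[k --> \oo] --> (t - 0) / (1 - 0).
    apply: cvgM; first by apply: cvgB => //; exact: cvg_nat_pow4.
    apply: cvgV; first by rewrite subr0.
    by apply: cvgB; [exact: cvg_cst|exact: cvg_nat_pow4].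
  rewrite !subr0 divr1; apply: cvg_trans; apply: near_eq_cvg.
  near=> k.
  have k0 : (4 ^ k)%:R != 0 :> R by rewrite pnatr_eq0 -lt0n expn_gt0.
  have nk : (4 ^ k)%:R - n%:R != 0 :> R.
    rewrite -natrB; last by rewrite ltnW //; near: k; exists n => // m /= nm;
      exact: leq_ltn_trans nm (ltn_expl _ _).
    rewrite pnatr_eq0 subn_eq0 -ltnNge; near: k; exists n => // m /= nm.
    exact: leq_ltn_trans nm (ltn_expl _ _).
  by field; rewrite nk k0.
apply: cvg_trans (cvgM IHn step); apply: near_eq_cvg.
near=> k; apply/esym/bin_ratio_recl; near: k; exists n => // m /= nm.
exact: leq_ltn_trans nm (ltn_expl _ _).
Unshelve. all: by end_near. Qed.

Variables (mu : {measure set motzkin_path -> \bar R}) (phi : nat -> nat -> R).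
Hypothesis mu_phi : cyl_density mu phi.

Let dev k (w : motzkin_path) : R := freq (4 ^ k.+1) w - freq (4 ^ k) w.

Let measurable_dev k : measurable_fun setT (dev k).
Proof. by apply: measurable_funB; exact: measurable_freq. Qed.

Lemma phi00_ge0 : 0 <= phi 0 0.
Proof. by rewrite -lee_fin -(cyl_density_mass mu_phi). Qed.

Let C : R := `|phi 1 0 - phi 2 0| + phi 0 0.

Let C0 : 0 <= C.
Proof. by rewrite addr_ge0 // phi00_ge0. Qed.

(** The inequality |x| <= (2^k x^2 + 2^-k) / 2 turns a square mean of order 4^-k
    into a mean of order 2^-k. *)
Let integral_dev k :
  (\int[mu]_w `|dev k w|%:E <= (C / (2 ^ (k + 1))%:R)%:E)%E.
Proof.
have p2 : (0 : R) < 2 ^+ k by rewrite exprn_gt0.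
apply: (@le_trans _ _ (\int[mu]_w ((2 ^+ k / 2)%:E * (dev k w ^+ 2)%:E +
                                   (2 ^- k / 2)%:E * (cst 1 w)))%E).
  apply: ge0_le_integral => //.
  - by apply/measurable_EFinP; exact: measurableT_comp.
  - apply/measurable_EFinP; apply: measurable_funD => //.
    by apply: measurable_funM => //; exact: measurable_funX.
  move=> w _; rewrite mule1 -EFinM -EFinD lee_fin.
  rewrite -(real_normK (num_real (dev k w))); move: `|dev k w| => x.
  rewrite -subr_ge0 [leRHS](_ : _ = 2 ^+ k * (x - 2 ^- k) ^+ 2 / 2).
    by rewrite divr_ge0 // mulr_ge0 ?sqr_ge0 // ltW.
  by field; rewrite gt_eqF.
have mdev2 : measurable_fun setT (fun w => (dev k w ^+ 2)%:E : \bar R).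
  by apply/measurable_EFinP; exact: measurable_funX.
have p2' : 0 <= 2 ^+ k / 2 :> R by rewrite divr_ge0 // ltW.
have p2'' : 0 <= 2 ^- k / 2 :> R by rewrite divr_ge0 // invr_ge0 ltW.
rewrite ge0_integralD //; first last.
- by move=> w _; rewrite mule1 lee_fin.
- exact: measurable_funeM.
- by move=> w _; rewrite -EFinM lee_fin mulr_ge0 ?sqr_ge0.
rewrite ge0_integralZl_EFin //; last by move=> w _; rewrite lee_fin sqr_ge0.
rewrite ge0_integralZl_EFin //.
rewrite integral_cst // mul1e (cyl_density_mass mu_phi).
rewrite (integral_freqB mu_phi) ?expn_gt0 ?leq_exp2l //.
rewrite -!EFinM -EFinD lee_fin.
have -> : (4 ^ k)%:R^-1 - (4 ^ k.+1)%:R^-1 = 3 / 4 * 2 ^- k * 2 ^- k :> R.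
  rewrite expnS natrM !natrX (_ : 4%:R = 2 ^+ 2) -?exprM 1?mulnC 1?exprM; last first.
    by rewrite -natrX.
  by field; rewrite gt_eqF.
rewrite addn1 natrX exprS /C.
have ab : phi 1 0 - phi 2 0 <= `|phi 1 0 - phi 2 0| by rewrite ler_norm.
have -> : 2 ^+ k / 2 * ((phi 1 0 - phi 2 0) * (3 / 4 * 2 ^- k * 2 ^- k)) +
          2 ^- k / 2 * phi 0 0 =
   (3 / 4 * (phi 1 0 - phi 2 0) + phi 0 0) / (2 * 2 ^+ k).
  by field; rewrite gt_eqF.
rewrite ler_pM2r ?invr_gt0 ?mulr_gt0 // lerD2r.
by have := normr_ge0 (phi 1 0 - phi 2 0); lra.
Qed.

(** The increments have summable means, so almost surely they are absolutely
    summable. *)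
Lemma ae_cvg_freq : {ae mu, forall w, setT w ->
  (fun k => freq (4 ^ k) w : R) @ \oo --> flat_freq w}.
Proof.
pose S w := (\sum_(k <oo) `|dev k w|%:E)%E.
have mdev k : measurable_fun setT (fun w => `|dev k w|%:E : \bar R).
  by apply/measurable_EFinP; exact: measurableT_comp.
have iS : mu.-integrable setT S.
  apply/integrableP; split; first exact: ge0_emeasurable_sum.
  apply: (@le_lt_trans _ _ (\int[mu]_w S w)%E).
    rewrite le_eqVlt; apply/orP; left; apply/eqP; apply: eq_integral => w _.
    by rewrite gee0_abs // nneseries_ge0.
  rewrite integral_nneseries //.
  apply: (@le_lt_trans _ _ (\sum_(k <oo) (C / (2 ^ (k + 1))%:R)%:E)%E).
    by apply: lee_nneseries => [k _ _|k _]; [exact: integral_ge0|exact: integral_dev].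
  rewrite [X in (X < _)%E](_ : _ = (C / 2 ^+ 0)%:E) ?ltry //.
  by apply/cvg_lim => //; exact: cvg_geometric_eseries_half.
have := integrable_ae measurableT iS; apply: filterS => w /(_ I) Sw _.
have cvgS : cvgn [normed series (dev ^~ w)].
  apply: nondecreasing_is_cvgn.
    by apply: nondecreasing_series => k _ _; exact: normr_ge0.
  exists (fine (S w)) => _ [n _ <-].
  rewrite -lee_fin fineK // /series /= -sumEFin.
  exact: nneseries_lim_ge.
have cvgF : cvgn (fun k => freq (4 ^ k) w : R).
  have := normed_cvg cvgS.
  rewrite (_ : dev ^~ w = telescope (fun k => freq (4 ^ k) w)) // telescopeK.
  move=> h; rewrite (_ : (fun k => _) = (fun k => (freq (4 ^ k) w - freq (4 ^ 0) w) + freq (4 ^ 0) w)).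
    by apply: is_cvgD => //; exact: is_cvg_cst.
  by apply/funext => k; rewrite subrK.
by rewrite /flat_freq cvg_limn_supE.
Qed.

(** The binomial moments of the number of flat steps are known exactly for every
    N; after division by 'C(N, n) the integrands are bounded by 1 and converge to
    the power of the frequency. *)
Lemma integral_flat_freqX n :
  (\int[mu]_w ((flat_freq w : R) ^+ n)%:E = (phi n 0)%:E)%E.
Proof.
pose g k (w : motzkin_path) : \bar R :=
  ('C(flats (4 ^ k) w, n)%:R / 'C(4 ^ k, n)%:R)%:E.
have mbin N : measurable_fun setT (fun w => ('C(flats N w, n)%:R)%:E : \bar R).
  under eq_fun do rewrite bin_flats -big_filter.
  apply: emeasurable_sum => I; apply/measurable_EFinP; apply: measurable_indic.
  exact: measurable_flat_on.
have mg k : measurable_fun setT (g k).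
  by rewrite /g; under eq_fun do rewrite mulrC EFinM; exact: measurable_funeM.
have mT : measurable_fun setT (fun w => ((flat_freq w : R) ^+ n)%:E).
  by apply/measurable_EFinP; apply: measurable_funX; exact: measurable_flat_freq.
have [|||_ _ lim_g] := @dominated_convergence _ _ R mu setT measurableT g
    (fun w => ((flat_freq w : R) ^+ n)%:E) (cst 1%E) mg mT.
- have := ae_cvg_freq; apply: filterS => w cvg_w Tw.
  apply: cvg_EFin; first by apply: nearW.
  exact/cvg_bin_ratio/cvg_w.
- apply/integrableP; split => //.
  rewrite (eq_integral (cst 1%E)) => [|w _]; last by rewrite /= normr1.
  by rewrite integral_cst // mul1e (cyl_density_fin mu_phi).
- apply: aeW => w k _; rewrite /g lee_fin ger0_norm ?divr_ge0 //.
  have [->|C'] := eqVneq 'C(4 ^ k, n) 0%N; first by rewrite invr0 mulr0.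
  rewrite ler_pdivrMr ?ltr0n ?lt0n // mul1r ler_nat leq_bin2l //.
  exact: flats_le.
apply: cvg_unique lim_g _ => //; apply: cvg_near_cst.
near=> k.
have nk : (n <= 4 ^ k)%N.
  near: k; exists n => // m /= nm; apply: leq_trans nm _.
  exact/ltnW/ltn_expl.
have C' : 'C(4 ^ k, n)%:R != 0 :> R by rewrite pnatr_eq0 -lt0n bin_gt0.
rewrite /= /g; under eq_integral do rewrite mulrC EFinM.
rewrite ge0_integralZl_EFin // (integral_bin_flats mu_phi) -EFinM.
by rewrite mulrA mulVf // mul1r.
Unshelve. all: by end_near. Qed.

End flat_moment_limit.

(** * Harmonic functions are determined by their axis values *)

Section harmonic_extension.
Context {R : realType}.

(** Harmonicity solved for its topmost term.  For n < d it involves truncated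
    predecessors and means nothing, but [axis_extensionE] still holds there. *)
Fixpoint axis_extension (c : nat -> R) (d n : nat) : R :=
  match d with
  | 0 => c n
  | d1.+1 => match d1 with
    | 0 => c n.-1 - c n
    | d2.+1 => axis_extension c d1 n.-1 - axis_extension c d1 n
                 - axis_extension c d2 n
    end
  end.

Lemma axis_extensionSS c d n : axis_extension c d.+2 n =
  axis_extension c d.+1 n.-1 - axis_extension c d.+1 n - axis_extension c d n.
Proof. by []. Qed.

Lemma axis_extensionE c d n : axis_extension c d n =
  at_pred (fun d => axis_extension c d n.+1) d + axis_extension c d n.+1
  + axis_extension c d.+1 n.+1.
Proof. by case: d => [|d] /=; ring. Qed.

Lemma harmonic_axis (phi : nat -> nat -> R) n d : path_harmonic phi -> (d <= n)%N ->
  phi n d = axis_extension (phi ^~ 0%N) d n.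
Proof.
move=> hphi; elim/ltn_ind: d n => d IHd [|n] dn.
  by move: dn; rewrite leqn0 => /eqP ->.
case: d IHd dn => [//|[|d]] IHd dn.
  by rewrite /= (hphi n 0) // /= ; ring.
rewrite axis_extensionSS.
rewrite -(IHd d.+1) // -(IHd d.+1) //; last exact: ltnW.
rewrite -(IHd d) //; last by lia.
by rewrite (hphi n d.+1) //=; ring.
Qed.

Lemma axis_extensionZ a c d n :
  axis_extension (fun k => a * c k) d n = a * axis_extension c d n.
Proof.
elim/ltn_ind: d n => -[|[|d]] IHd n //; first by rewrite /=; ring.
rewrite !axis_extensionSS (IHd d.+1) // (IHd d.+1) // (IHd d) //; ring.
Qed.

Lemma eq_axis_extension c c' d n : (forall k, c k = c' k) ->
  axis_extension c d n = axis_extension c' d n.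
Proof. by move=> cc'; rewrite (_ : c = c') //; exact/funext. Qed.

Lemma measurable_axis_extension d' (T : measurableType d')
    (f : nat -> T -> R) d n :
  (forall k, measurable_fun setT (f k)) ->
  measurable_fun setT (fun w => axis_extension (f ^~ w) d n).
Proof.
move=> mf; elim/ltn_ind: d n => -[|[|d]] IHd n; [exact: mf|exact: measurable_funB|].
apply: measurable_funB; last exact: (IHd d _ n).
by apply: measurable_funB; [exact: (IHd d.+1 _ n.-1)|exact: (IHd d.+1 _ n)].
Qed.

(** The extension is a finite linear combination of axis values, hence commutes
    with integration over a random axis sequence. *)
Lemma integral_axis_extension d' (T : measurableType d')
    (mu : {measure set T -> \bar R}) (f : nat -> T -> R) (c : nat -> R) d n :
  (forall k, mu.-integrable setT (EFin \o f k)) ->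
  (forall k, (\int[mu]_w (f k w)%:E = (c k)%:E)%E) ->
  mu.-integrable setT (fun w => (axis_extension (f ^~ w) d n)%:E) /\
  (\int[mu]_w (axis_extension (f ^~ w) d n)%:E = (axis_extension c d n)%:E)%E.
Proof.
move=> fi fc; elim/ltn_ind: d n => -[|[|d]] IHd n.
- by split; [exact: fi|exact: fc].
- split; first by apply: (integrableB measurableT (fi n.-1) (fi n)).
  rewrite (eq_integral (fun w => (f n.-1 w)%:E - (f n w)%:E)%E) //.
  by rewrite (integralB measurableT (fi n.-1) (fi n)) !fc.
have [i1 e1] := IHd d.+1 (leqnn _) n.-1.
have [i2 e2] := IHd d.+1 (leqnn _) n.
have [i3 e3] := IHd d (leqnSn _) n.
have i12 := integrableB measurableT i1 i2.
split; first exact: (integrableB measurableT i12 i3).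
rewrite (eq_integral (fun w => (axis_extension (f ^~ w) d.+1 n.-1)%:E
  - (axis_extension (f ^~ w) d.+1 n)%:E - (axis_extension (f ^~ w) d n)%:E)%E) //.
rewrite (integralB measurableT i12 i3) (integralB measurableT i1 i2).
by rewrite e1 e2 e3.
Qed.

End harmonic_extension.

Section tail_invariance.
Context {R : realType}.

(** A perturbation tending to 0 does not increase the limit superior. *)
Lemma limn_sup_cvg0_le (u v : R^o^nat) : bounded_fun u -> bounded_fun v ->
  (fun k => v k - u k) @ \oo --> (0 : R^o) -> limn_sup v <= limn_sup u.
Proof.
move=> bu bv uv0.
have -> : v = u \+ (fun k => v k - u k) by apply/funext => k /=; rewrite addrC subrK.
have buv : bounded_fun (fun k => v k - u k).
  by apply/cvg_seq_bounded/cvg_ex; exists 0.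
apply: le_trans (le_limn_supD bu buv) _.
by rewrite (cvg_limn_inf_sup uv0).2 addr0.
Qed.

Lemma flats_tail (w w' : motzkin_path) N n :
  (forall k, (N <= k)%N -> w k = w' k) ->
  `|(flats n w)%:R - (flats n w')%:R| <= N%:R :> R.
Proof.
move=> ww'.
suff : (flats n w <= flats n w' + N)%N /\ (flats n w' <= flats n w + N)%N.
  rewrite -!(ler_nat R) !natrD => -[h1 h2].
  by rewrite ler_norml; apply/andP; split; lra.
suff le (u u' : motzkin_path) : (forall k, (N <= k)%N -> u k = u' k) ->
    (flats n u <= flats n u' + N)%N.
  by split; apply: le => // k Nk; rewrite ww'.
move=> uu'; rewrite /flats.
elim: n => [|n IHn]; first by rewrite big_ord0.
rewrite !big_ord_recr /=.
have [Nn|nN] := leqP N n.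
  by rewrite !uu' ?leqW // addnAC leq_add2r.
have := flats_le n u; have := leq_b1 (u n.+1 == u n); rewrite /flats.
move: (\sum_(i < n) _)%N (\sum_(i < n) _)%N (nat_of_bool _) (nat_of_bool _).
by move=> a b c d; lia.
Qed.

(** The numbers of flat steps of tail-equivalent paths differ by a bounded amount,
    negligible after division by 4^k. *)
Lemma flat_freq_tail w w' : tail_equiv w w' -> flat_freq w = flat_freq w' :> R.
Proof.
wlog suff le : w w' / tail_equiv w w' -> flat_freq w' <= flat_freq w :> R.
  move=> ww'; apply/eqP; rewrite eq_le !le //.
  by case: ww' => N ww'; exists N => n Nn; rewrite ww'.
move=> [N ww']; apply: limn_sup_cvg0_le; [exact: freq_bounded..|].
apply/cvgr0Pnorm_le => e e0.
have := @cvg_nat_pow4 R N => /cvgr0Pnorm_le/(_ e e0); apply: filterS => k /=.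
apply: le_trans; rewrite -mulrBl normrM [leRHS]normrM.
rewrite ler_wpM2r // distrC ger0_norm //; exact: flats_tail.
Qed.

Lemma flat_freq_tail_invariant (B : set R) :
  tail_invariant (flat_freq @^-1` B).
Proof. by move=> w w' ww' /=; rewrite (flat_freq_tail ww'). Qed.

End tail_invariance.

(** * Central measures and their restrictions to tail events *)

Lemma measurable_to_paths d (T : measurableType d) (g : T -> motzkin_path) :
  (forall i a, measurable [set x | g x i = a]) -> measurable_fun setT g.
Proof.
move=> mg; apply: (measurability _ cyl_or_empty_sigma).
move=> _ [_ [->|[n [w ->]]] <-]; first by rewrite preimage_set0 setI0.
rewrite setTI (_ : _ @^-1` _ =
    \bigcap_(i in [set i | (i <= n)%N]) [set x | g x i = w i]) //.
rewrite bigcap_mkcond; apply: bigcapT_measurable => i.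
by case: ifP.
Qed.

Section central_measures.
Context {R : realType}.

(** Centrality without conditional probabilities; it makes sense for measures of
    any total mass, such as restrictions to events. *)
Definition end_determined (nu : set motzkin_path -> \bar R) :=
  forall n (w w' : motzkin_path), w n = w' n ->
  nu (prefix_cyl n w) = nu (prefix_cyl n w').

Definition density (nu : set motzkin_path -> \bar R) (n d : nat) : R :=
  fine (nu (prefix_cyl n (level_path d))).

Lemma end_determined_density (nu : {measure set motzkin_path -> \bar R}) :
  (nu setT < +oo)%E -> end_determined nu -> cyl_density nu (density nu).
Proof.
move=> fin nuE n w; rewrite fineK.
  by apply: nuE; rewrite level_path_end // height_le.
rewrite ge0_fin_numE //; apply: le_lt_trans fin.
by apply: le_measure; rewrite ?inE //; exact: measurable_prefix_cyl.
Qed.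

Lemma measure_passesI (nu : {measure set motzkin_path -> \bar R}) n d B :
  measurable B -> nu (passes n d `&` B) =
  (\sum_(p in motzkin_to n d) nu (cylinder p `&` B))%E.
Proof.
move=> mB; rewrite (_ : passes n d `&` B =
    \bigcup_(p in [set` motzkin_to n d]) (cylinder p `&` B)); last first.
  apply/seteqP; split=> [w [wn Bw]|w [p /= /motzkin_toP[w' -> <-]]].
    exists (history n w); last by rewrite cylinder_history.
    by rewrite /= -wn history_motzkin.
  by rewrite cylinder_history => -[/(_ n (leqnn n))].
rewrite measure_fin_bigcup.
- rewrite -(@bigfs _ _ _ _ (index_enum _)) //; first exact: index_enum_uniq.
  by move=> p _; rewrite mem_index_enum.
- exact: finite_finset.
- move=> p q /= /motzkin_toP[w -> _] /motzkin_toP[w' -> _].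
  rewrite !cylinder_history => -[u [[uw _] [uw' _]]]; apply/eq_history => i lein.
  by rewrite -uw // uw'.
- move=> p /= /motzkin_toP[w -> _]; apply: measurableI => //.
  by rewrite cylinder_history; exact: measurable_prefix_cyl.
Qed.

Lemma measure_passes (nu : {measure set motzkin_path -> \bar R}) phi n d :
  cyl_density nu phi ->
  nu (passes n d) = ((motzkin_count n d)%:R * phi n d)%:E.
Proof.
move=> nu_phi; rewrite -[passes n d]setIT measure_passesI //.
rewrite (eq_bigr (fun=> (phi n d)%:E)).
  by rewrite sumEFin sumr_const mulr_natl.
move=> p /motzkin_toP[w -> <-]; rewrite setIT cylinder_history; exact: nu_phi.
Qed.

(** A point that is reached with probability 0 gives probability 0 to every path
    ending there, so the silence of [central] about such points is harmless. *)
Lemma central_end_determined (nu : probability motzkin_path R) :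
  central nu -> end_determined nu.
Proof.
move=> cnu n w w' ww'.
have fin A : measurable A -> nu A \is a fin_num by move=> mA; exact: fin_num_measure.
have mp := measurable_passes n (w n).
have sub (u : motzkin_path) : u n = w n -> prefix_cyl n u `<=` passes n (w n).
  by move=> <- v /(_ n (leqnn n)).
have [nu0|] := eqVneq (nu (passes n (w n))) 0%E.
  have null (u : motzkin_path) : u n = w n -> nu (prefix_cyl n u) = 0%E.
    move=> un; apply/eqP; rewrite eq_le measure_ge0 andbT -nu0.
    by apply: le_measure; rewrite ?inE //; [exact: measurable_prefix_cyl|exact: sub].
  by rewrite !null.
rewrite neq_lt ltNge measure_ge0 /= => nu_gt0.
have fine0 : fine (nu (passes n (w n))) != 0.
  by rewrite gt_eqF // fine_gt0 // nu_gt0 /= -ge0_fin_numE // fin.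
have E (u : motzkin_path) : u n = w n -> nu (prefix_cyl n u) =
    ((motzkin_count n (w n))%:R^-1 * fine (nu (passes n (w n))))%:E.
  move=> un; have := cnu n (w n) nu_gt0 (history n u).
  rewrite -un history_motzkin => /(_ isT); rewrite /cprob cylinder_history un.
  rewrite setIidl; last exact: sub.
  move=> <-; rewrite divfK // fineK //; apply: fin.
  exact: measurable_prefix_cyl.
by rewrite !E.
Qed.

Lemma cyl_density_central (nu : probability motzkin_path R) phi :
  cyl_density nu phi -> central nu.
Proof.
move=> nu_phi n d nu_gt0 p /motzkin_toP[w -> wn].
rewrite /cprob cylinder_history setIidl; last first.
  by rewrite -wn => u /(_ n (leqnn n)).
move: nu_gt0; rewrite (measure_passes _ _ nu_phi) nu_phi wn lte_fin /=.
rewrite pmulr_rgt0; last by rewrite ltr0n motzkin_count_gt0 // -wn height_le.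
by move=> phi_gt0; rewrite invfM mulrCA mulfV ?mulr1 // gt_eqF.
Qed.

(** Paths that do not visit (n, w1 n) are left alone, because the prefix of w1
    cannot be glued to their future. *)
Definition swap_prefix n (w1 u : motzkin_path) : motzkin_path :=
  match u n =P w1 n with
  | ReflectT h => splice h
  | ReflectF _ => u
  end.

Lemma swap_prefixE n (w1 u : motzkin_path) i : swap_prefix n w1 u i =
  if (u n == w1 n) && (i <= n)%N then w1 i else u i.
Proof. by rewrite /swap_prefix; case: eqP. Qed.

Lemma swap_prefix_tail n w1 u : tail_equiv (swap_prefix n w1 u) u.
Proof.
by exists n.+1 => i ni; rewrite swap_prefixE leqNgt ni andbF.
Qed.

Lemma measurable_swap_prefix n w1 : measurable_fun setT (swap_prefix n w1).
Proof.
apply: measurable_to_paths => i a.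
rewrite (_ : [set x | _] = (passes n (w1 n) `&` [set x | (if (i <= n)%N then w1 i else x i) = a])
   `|` (~` passes n (w1 n) `&` passes i a)).
  apply: measurableU; apply: measurableI.
  - exact: measurable_passes.
  - case: (i <= n)%N; last exact: measurable_passes.
    rewrite (_ : [set x | _] = if w1 i == a then setT else set0).
      by case: ifP => _; [exact: measurableT|exact: measurable0].
    by apply/seteqP; split=> u /=; case: eqP.
  - by apply: measurableC; exact: measurable_passes.
  - exact: measurable_passes.
apply/seteqP; split=> u /=; rewrite swap_prefixE /passes /=; case: eqP => /= h.
- by left.
- by right.
- by case=> [[]|[]].
- by case=> [[]|[]].
Qed.

(** Exchanging prefixes maps nu restricted to the cylinder of w0 to nu restricted to
    the cylinder of w1, as can be checked on cylinders, and it preserves A. *)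
Lemma end_determined_tail (nu : {measure set motzkin_path -> \bar R}) A :
  (nu setT < +oo)%E -> end_determined nu -> measurable A -> tail_invariant A ->
  end_determined (fun B => nu (B `&` A)).
Proof.
move=> fin nuE mA tA n w0 w1 w01.
have mth := measurable_swap_prefix n w1.
have m0 := measurable_prefix_cyl n w0.
have m1 := measurable_prefix_cyl n w1.
pose mu1 : {measure set motzkin_path -> \bar R} := mrestr nu m1.
pose mu0' : {measure set motzkin_path -> \bar R} := mrestr nu m0.
pose mu0 : {measure set motzkin_path -> \bar R} := pushforward mu0' (swap_prefix n w1).
have fin1 : (mu1 setT < +oo)%E.
  rewrite /mu1 /= /mrestr setTI; apply: le_lt_trans fin.
  by apply: le_measure; rewrite ?inE.
have swapE (u : motzkin_path) i : prefix_cyl n w0 u ->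
    swap_prefix n w1 u i = if (i <= n)%N then w1 i else u i.
  by move=> uw0; rewrite swap_prefixE uw0 // w01 eqxx.
have eq_cyl m v : mu1 (prefix_cyl m v) = mu0 mth (prefix_cyl m v).
  rewrite /mu1 /mu0 /mu0' /pushforward /= /mrestr.
  have [mn|/ltnW nm] := leqP m n.
    rewrite prefix_cylI //; case: asboolP => h.
      rewrite -(nuE _ _ _ w01); congr (nu _); apply/esym/setIidr => u uw0 i im.
      by rewrite swapE // (leq_trans im mn) h.
    rewrite measure0 [X in _ = nu X](_ : _ = set0) ?measure0 //.
    apply/seteqP; split=> // u [uv uw0]; apply: h => i im.
    by rewrite -(uv i im) swapE // (leq_trans im mn).
  rewrite setIC prefix_cylI //; case: asboolP => h; last first.
    rewrite [X in _ = nu X](_ : _ = set0) ?measure0 //.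
    apply/seteqP; split=> // u [uv uw0]; apply: h => i im.
    by rewrite -(uv i (leq_trans im nm)) swapE // im.
  have vn : v n = w0 n by rewrite h // w01.
  rewrite [X in _ = nu X](_ : _ = prefix_cyl m (splice vn)).
    apply: nuE => /=; case: leqP => // mn.
    by have -> : m = n by apply/eqP; rewrite eqn_leq mn nm.
  apply/seteqP; split=> u.
    move=> [uv uw0] i im /=; case: leqP => [lein|ni]; first exact: uw0.
    by have := uv i im; rewrite swapE // leqNgt ni.
  move=> uvn; have uw0 : prefix_cyl n w0 u.
    by move=> i lein; rewrite uvn ?(leq_trans lein) //= lein.
  split=> // i im; rewrite swapE //; case: leqP => [lein|ni]; first by rewrite h.
  by rewrite uvn //= leqNgt ni.
have := eq_measure_cyl fin1 eq_cyl mA.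
rewrite /mu1 /mu0 /mu0' /pushforward /= /mrestr setIC => ->.
rewrite setIC; congr (nu (_ `&` _)); apply/seteqP; split=> u /=.
  by apply: tA; case: (swap_prefix_tail n w1 u) => N h; exists N => k Nk; rewrite h.
by apply: tA; exact: swap_prefix_tail.
Qed.

End central_measures.

(** * The extreme densities *)

Section extreme_densities.
Context {R : realType}.
Implicit Types (t : R) (l : R * R) (nu : probability motzkin_path R).

(** The harmonic function with axis values t^n. *)
Definition power_density t (n d : nat) : R :=
  axis_extension (fun k => t ^+ k) d n.

(** At t > 0 the density is t^n u_d with u_(d+1) + u_d + u_(d-1) = u_d / t.  If
    t > 1/3 and u is nonnegative, then u is concave, hence nondecreasing and at
    least 1, so its increments decrease by at least 3 - 1/t > 0 at every step and
    end up negative. *)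
Lemma power_density_ge0_le t : 0 <= t ->
  (forall n d, (d <= n)%N -> 0 <= power_density t n d) -> 3 * t <= 1.
Proof.
move=> t0 pos; rewrite leNgt; apply/negP => t3.
have {}t0 : 0 < t by lra.
pose fix u d : R := if d is d1.+1 then
  (if d1 is d2.+1 then (t^-1 - 1) * u d1 - u d2 else t^-1 - 1) else 1.
have uSS d : u d.+2 = (t^-1 - 1) * u d.+1 - u d by [].
have uE d n : (d <= n)%N -> power_density t n d = t ^+ n * u d.
  rewrite /power_density; elim/ltn_ind: d n => -[|[|d]] IHd [|n] dn //.
  - by rewrite /= expr0 mulr1.
  - by rewrite /= mulr1.
  - by rewrite /= exprS; field; rewrite gt_eqF.
  rewrite axis_extensionSS uSS !IHd //; last 2 first; try by lia.
  by rewrite /= exprS; field; rewrite gt_eqF.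
have u_ge0 d : 0 <= u d.
  by have := pos d d (leqnn d); rewrite uE // pmulr_rge0 // exprn_gt0.
(* The increments satisfy delta (d+1) = delta d - k * u (d+1). *)
pose k := 3 - t^-1.
have k0 : 0 < k by rewrite /k subr_gt0 -[3]invrK ltf_pV2 ?posrE //; lra.
pose delta d := u d.+1 - u d.
have deltaS d : delta d.+1 = delta d - k * u d.+1.
  by rewrite /delta uSS /k; ring.
have delta_ni d e : delta (d + e)%N <= delta d.
  elim: e => [|e IHe]; first by rewrite addn0.
  rewrite addnS deltaS; apply: le_trans IHe.
  by rewrite gerBl mulr_ge0 // ltW.
have u_le d e : u (d + e)%N <= u d + e%:R * delta d.
  elim: e => [|e IHe]; first by rewrite addn0 mul0r addr0.
  have := delta_ni d e; rewrite /delta addnS -(natr1 e) mulrDl mul1r => h.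
  by rewrite -/(delta d) in h *; lra.
have delta_ge0 d : 0 <= delta d.
  rewrite leNgt; apply/negP => dd.
  pose e := Num.bound `|u d / - delta d|.
  have : u d / - delta d < e%:R.
    by rewrite (le_lt_trans (ler_norm _)) // archi_boundP // normr_ge0.
  rewrite ltr_pdivrMr ?oppr_gt0 // => he.
  by have := u_le d e; have := u_ge0 (d + e)%N; lra.
have u_ge1 d : 1 <= u d.
  elim: d => [//|d IHd]; apply: le_trans IHd _.
  by have := delta_ge0 d; rewrite /delta; lra.
have delta_le d : delta d <= delta 0%N - d%:R * k.
  elim: d => [|d IHd]; first by rewrite mul0r subr0.
  rewrite deltaS -(natr1 d) (mulrDl d%:R) mul1r.
  have : k <= k * u d.+1 by rewrite ler_peMr // ltW.
  by lra.
pose e := Num.bound `|delta 0%N / k|.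
have : delta 0%N / k < e%:R.
  by rewrite (le_lt_trans (ler_norm _)) // archi_boundP // normr_ge0.
rewrite ltr_pdivrMr // => he.
by have := delta_le e; have := delta_ge0 e; lra.
Qed.

(** The two roots of X^2 - (1 - t) X + t^2, the larger first; they are real when
    3 t <= 1. *)
Definition param_of t : R * R :=
  let s := Num.sqrt ((1 - 3 * t) * (1 + t)) in
  ((1 - t + s) / 2, (1 - t - s) / 2).

Lemma param_of_flat t : 1 - (param_of t).1 - (param_of t).2 = t.
Proof. by rewrite /param_of /=; field. Qed.

Lemma param_of_product t : 0 <= t -> 3 * t <= 1 ->
  (param_of t).1 * (param_of t).2 = t ^+ 2.
Proof.
move=> t0 t3; rewrite /param_of /=; set s := Num.sqrt _.
have s2 : s ^+ 2 = (1 - 3 * t) * (1 + t) by rewrite sqr_sqrtr // mulr_ge0 //; lra.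
transitivity (((1 - t) ^+ 2 - s ^+ 2) / 4); first by field.
by rewrite s2; field.
Qed.

Lemma param_set_param_of t : 0 <= t -> 3 * t <= 1 -> param_set (param_of t).
Proof.
move=> t0 t3; rewrite /param_of; set s := Num.sqrt _.
have s0 : 0 <= s by exact: sqrtr_ge0.
have s2 : s ^+ 2 = (1 - 3 * t) * (1 + t) by rewrite sqr_sqrtr // mulr_ge0 //; lra.
have st : s <= 1 - t.
  rewrite -(@ler_pXn2r _ 2) ?nnegrE //; last by lra.
  by rewrite s2; have := sqr_ge0 t; lra.
by split => /=; try (apply/andP; split); lra.
Qed.

End extreme_densities.

Section markov_chain.
Context {R : realType}.
Implicit Types (t : R) (l : R * R) (nu : probability motzkin_path R).

Lemma cyl_passes_next nu phi n (w : motzkin_path) d : cyl_density nu phi ->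
  nu (prefix_cyl n w `&` passes n.+1 d) =
  (if motzkin_step (w n) d then phi n.+1 d else 0)%:E.
Proof.
move=> nu_phi; case: ifPn => h.
  by rewrite -prefix_cylS nu_phi turn_last.
rewrite (_ : _ `&` _ = set0) ?measure0 //; apply/seteqP; split=> // u [uw ud].
by apply: (negP h); rewrite -uw // -ud; exact: height_step.
Qed.

Lemma passes_next nu phi n d d' : cyl_density nu phi ->
  nu (passes n d `&` passes n.+1 d') =
  ((motzkin_count n d)%:R * (if motzkin_step d d' then phi n.+1 d' else 0))%:E.
Proof.
move=> nu_phi; rewrite measure_passesI; last exact: measurable_passes.
rewrite (eq_bigr (fun=> (if motzkin_step d d' then phi n.+1 d' else 0)%:E)).
  by rewrite sumEFin sumr_const mulr_natl.
move=> p /motzkin_toP[w -> <-]; rewrite cylinder_history.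
exact: cyl_passes_next.
Qed.

Lemma power_density_is_M nu l (t := 1 - l.1 - l.2) :
  l.1 * l.2 = t ^+ 2 -> cyl_density nu (power_density t) -> is_M l nu.
Proof.
move=> lt nu_t; pose phi := power_density t.
have m0 n d : (d <= n)%N -> (motzkin_count n d)%:R != 0 :> R.
  by move=> dn; rewrite pnatr_eq0 -lt0n motzkin_count_gt0.
have hphi : path_harmonic phi := cyl_density_harmonic nu_t.
exists (fun n d => (motzkin_count n d)%:R * phi n d); split.
- by move=> n; rewrite axis_prob_diag.
- split=> [[//|n] _ /=|[|n] d /andP[d0 dn] //].
    rewrite (hphi n 0%N) //= add0r.
    by field; rewrite !m0.
  case: d d0 dn => // d _ dn /=.
  rewrite (hphi n d.+1) //=.
  by field; rewrite !m0 // 1?ltnW // ltnW.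
- by move=> n; rewrite (measure_passes _ _ nu_t).
- move=> n d d' p /motzkin_toP[w -> wn]; rewrite cylinder_history nu_t lte_fin wn.
  move=> phi0; rewrite /cprob ![passes n.+1 d' `&` _]setIC.
  rewrite (cyl_passes_next _ _ _ nu_t) (passes_next _ _ _ nu_t) nu_t.
  rewrite (measure_passes _ _ nu_t) wn /= invfM mulrACA mulfV ?mul1r //.
  by rewrite m0 // -wn height_le.
- move=> n d d' dd'; have [nd|dn] := ltnP n d.
    by rewrite (measure_passes _ _ nu_t) motzkin_count_gt // mul0r ltxx.
  rewrite (measure_passes _ _ nu_t) lte_fin => h.
  rewrite /cprob setIC (passes_next _ _ _ nu_t) (measure_passes _ _ nu_t) dd' /=.
  have phi0 : phi n d != 0.
    by apply: contraTneq h => e; rewrite -/phi e mulr0 ltxx.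
  have d'n : (d' <= n.+1)%N by case/andP: dd' => _ h'; apply: leq_trans h' _.
  by rewrite -/phi; field; rewrite phi0 !m0.
Qed.

End markov_chain.

(** * Ergodicity and constancy of the frequency *)

Section frequency_law.
Context {R : realType}.
Implicit Types (nu : {measure set motzkin_path -> \bar R}).

Lemma measurable_flat_freqX n :
  measurable_fun setT (fun w => ((flat_freq w : R) ^+ n)%:E).
Proof.
by apply/measurable_EFinP; apply: measurable_funX; exact: measurable_flat_freq.
Qed.

(** The integral of T^n (T - s)^2 is nonnegative, T being the frequency. *)
Lemma moment_quadratic nu phi n s : cyl_density nu phi -> 0 <= s ->
  2 * s * phi n.+1 0%N <= phi n.+2 0%N + s ^+ 2 * phi n 0%N.
Proof.
move=> nu_phi s0; rewrite -lee_fin EFinD !EFinM.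
rewrite -!(integral_flat_freqX nu_phi) -EFinM.
have T0 k w : (0 <= ((flat_freq w : R) ^+ k)%:E)%E.
  by rewrite lee_fin exprn_ge0 //; case/andP: (@flat_freq_itv R w).
have mT := measurable_flat_freqX.
rewrite -!ge0_integralZl_EFin ?mulr_ge0 ?sqr_ge0 //.
rewrite -ge0_integralD //; last 2 first.
- by move=> w _; apply: mule_ge0 => //; rewrite lee_fin sqr_ge0.
- by apply: measurable_funeM; exact: mT.
apply: ge0_le_integral => //.
- by move=> w _; apply: mule_ge0 => //; rewrite lee_fin mulr_ge0.
- by apply: measurable_funeM; exact: mT.
- by apply: emeasurable_funD; [exact: mT|apply: measurable_funeM; exact: mT].
move=> w _; rewrite -!EFinM -EFinD lee_fin.
have /andP[x0 _] := @flat_freq_itv R w.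
have h : 0 <= (flat_freq w : R) ^+ n * (flat_freq w - s) ^+ 2.
  by apply: mulr_ge0; [exact: exprn_ge0|exact: sqr_ge0].
by rewrite !exprS; move: h; rewrite !exprS; move: (_ ^+ n) => y; lra.
Qed.

(** The variance of the frequency is t^2 - t * t. *)
Lemma flat_freq_cst nu t : cyl_density nu (power_density t) ->
  {ae nu, forall w, flat_freq w = t}.
Proof.
move=> nu_t.
have T0 k w : (0 <= ((flat_freq w : R) ^+ k)%:E)%E.
  by rewrite lee_fin exprn_ge0 //; case/andP: (@flat_freq_itv R w).
have mT := measurable_flat_freqX.
have mT1 : measurable_fun setT (fun w => (flat_freq w : R)) by exact: measurable_flat_freq.
have nu1 : nu setT = 1%E by rewrite (cyl_density_mass nu_t).
have E k : (\int[nu]_w ((flat_freq w : R) ^+ k)%:E = (t ^+ k)%:E)%E.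
  by rewrite (integral_flat_freqX nu_t).
have t0 : 0 <= t.
  by rewrite -lee_fin -[t]expr1 -E; apply: integral_ge0 => w _.
have mD : measurable_fun setT (fun w => ((flat_freq w - t) ^+ 2)%:E).
  by apply/measurable_EFinP; apply: measurable_funX; apply: measurable_funB.
have D0 w : (0 <= ((flat_freq w - t) ^+ 2)%:E)%E by rewrite lee_fin sqr_ge0.
have : (\int[nu]_w (((flat_freq w - t) ^+ 2)%:E
      + ((2 * t)%:E * ((flat_freq w : R) ^+ 1)%:E)) =
   \int[nu]_w (((flat_freq w : R) ^+ 2)%:E + cst (t ^+ 2)%:E w))%E.
  by apply: eq_integral => w _; rewrite /cst -EFinM -!EFinD; congr (_%:E); ring.
rewrite ge0_integralD //; last 2 first.
- by move=> w _; apply: mule_ge0 => //; rewrite lee_fin mulr_ge0.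
- exact: measurable_funeM.
rewrite ge0_integralZl_EFin ?mulr_ge0 // [RHS]ge0_integralD //; last first.
  by move=> w _; rewrite /cst lee_fin sqr_ge0.
rewrite !E integral_cst // nu1 mule1 -EFinM -EFinD.
set c := (X in (_ + X%:E)%E = _).
move=> /(congr1 (fun y => y - c%:E)%E); rewrite addeK // -EFinB.
rewrite (_ : _ - c = 0); last by rewrite /c; ring.
move=> I0; have : (\int[nu]_w `|((flat_freq w - t) ^+ 2)%:E| = 0)%E.
  by rewrite -[RHS]I0; apply: eq_integral => w _; rewrite gee0_abs.
move/(ae_eq_integral_abs _ measurableT mD); apply: filterS => w /(_ I) /= [] /eqP.
by rewrite sqrf_eq0 subr_eq0 => /eqP.
Qed.

(** The axis values are the moments of the frequency, here the total mass times
    t^n, and they determine the density. *)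
Lemma cyl_density_of_cst nu t : (nu setT < +oo)%E -> end_determined nu ->
  {ae nu, forall w, flat_freq w = t} ->
  forall n w, nu (prefix_cyl n w) =
    (fine (nu setT) * power_density t n (w n))%:E.
Proof.
move=> fin nuE Tt n w; have nu_psi := end_determined_density fin nuE.
rewrite nu_psi (harmonic_axis (cyl_density_harmonic nu_psi)) ?height_le //.
rewrite /power_density -axis_extensionZ; congr (_%:E).
apply: eq_axis_extension => k.
apply: EFin_inj; rewrite -(integral_flat_freqX nu_psi).
rewrite (ae_eq_integral (cst (t ^+ k)%:E)) //.
- rewrite integral_cst // EFinM fineK ?ge0_fin_numE //.
  by rewrite muleC.
- exact: measurable_flat_freqX.
- by apply: filterS Tt => u Tu _; rewrite Tu.
Qed.

End frequency_law.

Section ergodicity.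
Context {R : realType}.
Implicit Types (nu : probability motzkin_path R).

Lemma cyl_density_end_determined (nu : set motzkin_path -> \bar R) phi :
  cyl_density nu phi -> end_determined nu.
Proof. by move=> nu_phi n w w' ww'; rewrite !nu_phi ww'. Qed.

(** The frequency is t on every tail event A too, so the restriction of nu to A is
    nu(A) times nu; evaluated at A this gives nu(A) = nu(A)^2. *)
Lemma power_density_ergodic nu t :
  cyl_density nu (power_density t) -> ergodic nu.
Proof.
move=> nu_t A mA tA.
have fin : (nu setT < +oo)%E by rewrite probability_setT ltry.
have finA : nu A \is a fin_num by exact: fin_num_measure.
pose nuA : {measure set motzkin_path -> \bar R} := mrestr nu mA.
have nuAT : nuA setT = nu A by rewrite /nuA /= /mrestr setTI.
have nuAE : end_determined nuA.
  exact: end_determined_tail fin (cyl_density_end_determined nu_t) mA tA.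
have finA' : (nuA setT < +oo)%E by rewrite nuAT -ge0_fin_numE.
have nuA_cst : {ae nuA, forall w, flat_freq w = t}.
  have [N [mN N0 subN]] := flat_freq_cst nu_t; exists N; split=> //.
  apply/eqP; rewrite eq_le measure_ge0 andbT /nuA /= /mrestr -N0.
  by apply: le_measure; rewrite ?inE //; exact: measurableI.
have a0 : 0 <= fine (nu A) by exact: fine_ge0.
pose nua : {measure set motzkin_path -> \bar R} := mscale (NngNum a0) nu.
have /(_ _ mA) : forall B, measurable B -> nuA B = nua B.
  apply: eq_measure_cyl => // n w.
  rewrite (cyl_density_of_cst finA' nuAE nuA_cst) nuAT.
  by rewrite EFinM -nu_t.
rewrite /nuA /nua /= /mrestr /mscale /= setIid => e.
have : fine (nu A) = fine (nu A) * fine (nu A).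
  by rewrite {1}[nu A]e fineM.
move/eqP; rewrite -subr_eq0 -{1}[fine _]mulr1 -mulrBr mulf_eq0 subr_eq0.
case/orP => /eqP h; [left|right]; first by rewrite -(fineK finA) h.
by rewrite -(fineK finA) -h.
Qed.

(** The distribution function of f only takes the values 0 and 1, and t is the
    point where it jumps. *)
Lemma ergodic_cst nu (f : motzkin_path -> R) :
  ergodic nu -> measurable_fun setT f -> (forall w, 0 <= f w <= 1) ->
  (forall s, tail_invariant [set w | f w <= s]) ->
  exists t, 0 <= t /\ {ae nu, forall w, f w = t}.
Proof.
move=> erg mf f01 tf.
have mle s : measurable [set w | f w <= s].
  rewrite (_ : [set w | _] = setT `&` f @^-1` `]-oo, s]%classic).
    exact: mf.
  by rewrite setTI; apply/seteqP; split=> w /=; rewrite in_itv.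
pose G := [set s : R | nu [set w | f w <= s] = 1%E].
have G1 : G 1.
  rewrite /G /= (_ : [set w | _] = setT) ?probability_setT //.
  by apply/seteqP; split=> // w _ /=; case/andP: (f01 w).
have Glb s : G s -> 0 <= s.
  move=> Gs; rewrite leNgt; apply/negP => s0; move: Gs; rewrite /G /=.
  rewrite (_ : [set w | _] = set0) ?measure0; first by move=> []/eqP; rewrite eq_sym oner_eq0.
  apply/seteqP; split=> // w /= fs; have /andP[f0 _] := f01 w; lra.
have hG : has_inf G by split; [exists 1|exists 0 => s /Glb].
pose t := inf G.
have t0 : 0 <= t by apply: lb_le_inf; [exists 1|move=> s /Glb].
exists t; split => //.
have null_gt k : nu [set w | t + k.+1%:R^-1 < f w] = 0%E.
  have k0 : 0 < k.+1%:R^-1 :> R by rewrite invr_gt0.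
  have [s Gs st] := inf_adherent k0 hG.
  have -> : [set w | t + k.+1%:R^-1 < f w] = ~` [set w | f w <= t + k.+1%:R^-1].
    by apply/seteqP; split=> w /=; rewrite ltNge => /negP.
  suff e1 : nu [set w | f w <= t + k.+1%:R^-1] = 1%E.
    by rewrite probability_setC // e1 subee.
  apply/eqP; rewrite eq_le probability_le1 //= -Gs; apply: le_measure; rewrite ?inE //.
  by move=> w /= /le_trans; apply; exact: ltW.
have null_le k : nu [set w | f w <= t - k.+1%:R^-1] = 0%E.
  have [//|G'] := erg _ (mle (t - k.+1%:R^-1)) (tf _).
  have : t <= t - k.+1%:R^-1 by apply: ge_inf => //; case: hG.
  by rewrite lerBrDr gerDl leNgt invr_gt0 ltr0n.
pose N k := [set w | t + k.+1%:R^-1 < f w] `|` [set w | f w <= t - k.+1%:R^-1].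
apply: (@negligibleS _ _ _ _ (\bigcup_k N k)); last first.
  apply: negligible_bigcup => k; apply: negligibleU.
    apply/negligibleP; last exact: null_gt.
    rewrite (_ : [set w | _] = ~` [set w | f w <= t + k.+1%:R^-1]).
      exact: measurableC.
    by apply/seteqP; split=> w /=; rewrite ltNge => /negP.
  by apply/negligibleP; last exact: null_le.
move=> w /= fwt.
have ft : 0 < `|f w - t| by rewrite normr_gt0 subr_eq0; apply/eqP.
pose k := Num.bound `|f w - t|^-1.
have hk : k.+1%:R^-1 < `|f w - t|.
  rewrite -[ltRHS]invrK ltf_pV2 ?posrE ?invr_gt0 //.
  have := @archi_boundP R `|f w - t|^-1; rewrite invr_ge0 => /(_ (normr_ge0 _)).
  by move=> /lt_le_trans; apply; rewrite ler_nat.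
exists k => //; rewrite /N /=.
move: hk; have [h|h] := leP t (f w) => hk.
  by left; move: hk; rewrite ger0_norm ?subr_ge0 // ltrBrDl.
by right; apply/ltW; move: hk; rewrite ltr0_norm ?subr_lt0 // opprB ltrBrDl ltrBrDr.
Qed.

Lemma ergodic_power_density nu : central nu -> ergodic nu ->
  exists t, 0 <= t /\ cyl_density nu (power_density t).
Proof.
move=> cnu erg.
have fin : (nu setT < +oo)%E by rewrite probability_setT ltry.
have [t [t0 Tt]] := ergodic_cst erg (@measurable_flat_freq R)
  (@flat_freq_itv R) (fun s => flat_freq_tail_invariant (B := [set x | x <= s])).
exists t; split=> // n w.
rewrite (cyl_density_of_cst fin (central_end_determined cnu) Tt).
rewrite -[RHS]mul1e -EFinM; congr (_ * _)%:E.
exact: (congr1 fine (probability_setT nu)).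
Qed.

End ergodicity.

(** * Chains with the prescribed axis probabilities *)

(** Going straight down from (n, w n). *)
Lemma path_to_axis (w : motzkin_path) n :
  exists u, prefix_cyl n w u /\ u (n + w n)%N = 0%N.
Proof.
have st i : motzkin_step (if (i <= n)%N then w i else w n - (i - n))%N
    (if (i.+1 <= n)%N then w i.+1 else w n - (i.+1 - n))%N.
  have [ltin|ltni] := ltnP i n; first by rewrite (ltnW ltin) height_step.
  have [lein|ltni'] := leqP i n; last by rewrite /motzkin_step; lia.
  have -> : i = n by apply/eqP; rewrite eqn_leq lein ltni.
  by rewrite /motzkin_step; lia.
exists (MotzkinPath (height := fun i => if (i <= n)%N then w i else _)
  (height_root w) st); split; first by move=> i /= ->.
rewrite /=; case: leqP => h; last by lia.
have wn0 : w n = 0%N by lia.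
by rewrite wn0 addn0.
Qed.

Section is_M_facts.
Context {R : realType}.
Variables (l : R * R) (nu : probability motzkin_path R).
Hypothesis hl : param_set l.
Variable v : nat -> nat -> R.
Hypothesis v_axis : forall n, v n 0%N = axis_prob l n.
Hypothesis v_rec : motzkin_recursion v.
Hypothesis nu_axis : forall n, fine (nu (passes n 0)) = v n 0%N.
Hypothesis nu_markov : Defs.markov nu.
Hypothesis nu_trans : motzkin_transitions nu v.

Let phi n d := v n d / (motzkin_count n d)%:R.

Let m0 n d : (d <= n)%N -> (motzkin_count n d)%:R != 0 :> R.
Proof. by move=> dn; rewrite pnatr_eq0 -lt0n motzkin_count_gt0. Qed.

Let hphi : path_harmonic phi.
Proof.
case: v_rec => rec0 rec1 n [_|d dn]; rewrite /phi /=.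
  have := rec0 n.+1 isT; rewrite /= add0r => h.
  have : v n.+1 1%N / (motzkin_count n.+1 1)%:R =
     ((motzkin_count n 0)%:R / (motzkin_count n.+1 1)%:R * v n.+1 1%N)
       / (motzkin_count n 0)%:R by field; rewrite !m0.
  by rewrite h => ->; field; rewrite !m0.
have := rec1 n.+1 d.+1; rewrite /= ltnS dn => /(_ isT) h.
have : v n.+1 d.+2 / (motzkin_count n.+1 d.+2)%:R =
   ((motzkin_count n d.+1)%:R / (motzkin_count n.+1 d.+2)%:R * v n.+1 d.+2)
     / (motzkin_count n d.+1)%:R by field; rewrite !m0.
by rewrite h => ->; field; rewrite !m0 // ?leqW // ltnW.
Qed.

Let fin A : measurable A -> nu A \is a fin_num.
Proof. by move=> mA; exact: fin_num_measure. Qed.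


Let axis0 : axis_prob l 0 = 1.
Proof. by rewrite /axis_prob big_ord1 /= !expr0 !mulr1 divr1. Qed.

(** The transition probabilities along a path telescope to phi as long as the
    path has positive probability; they say nothing about the other paths. *)
Let dichotomy n (w : motzkin_path) :
  nu (prefix_cyl n w) = 0%E \/ nu (prefix_cyl n w) = (phi n (w n))%:E.
Proof.
elim: n => [|n [IHn|IHn]].
- right; rewrite prefix_cyl0 probability_setT /phi height_root v_axis axis0.
  by rewrite motzkin_count0 divr1.
- left; apply/eqP; rewrite eq_le measure_ge0 andbT -IHn.
  apply: le_measure; rewrite ?inE //; try exact: measurable_prefix_cyl.
  exact: prefix_cyl_sub.
have [nu0|] := eqVneq (nu (prefix_cyl n w)) 0%E.
  left; apply/eqP; rewrite eq_le measure_ge0 andbT -nu0.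
  apply: le_measure; rewrite ?inE //; try exact: measurable_prefix_cyl.
  exact: prefix_cyl_sub.
rewrite neq_lt ltNge measure_ge0 /= => nu_gt0; right.
have phi_gt0 : 0 < phi n (w n) by rewrite -lte_fin -IHn.
have sub : prefix_cyl n w `<=` passes n (w n) by move=> u /(_ n (leqnn n)).
have pass_gt0 : (0 < nu (passes n (w n)))%E.
  apply: lt_le_trans nu_gt0 _; apply: le_measure; rewrite ?inE //.
    exact: measurable_prefix_cyl.
  exact: measurable_passes.
have st := height_step w n.
have E : prefix_cyl n.+1 w = passes n.+1 (w n.+1) `&` prefix_cyl n w.
  apply/seteqP; split=> [u uw|u [un uw] i].
    split; first exact: uw.
    by move=> i lein; rewrite uw // leqW.
  by rewrite leq_eqVlt ltnS => /orP[/eqP -> //|]; exact: uw.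
have := nu_markov (w n.+1) (history_motzkin n w).
rewrite cylinder_history => /(_ nu_gt0).
rewrite (nu_trans st pass_gt0) /cprob -E IHn /= => h.
rewrite -(fineK (fin (measurable_prefix_cyl _ _))); congr (_%:E).
have -> : fine (nu (prefix_cyl n.+1 w)) =
    fine (nu (prefix_cyl n.+1 w)) / phi n (w n) * phi n (w n).
  by rewrite divfK // gt_eqF.
rewrite h /phi; field; rewrite !m0 ?height_le //=.
by apply: contraTneq phi_gt0 => e; rewrite /phi e mul0r ltxx.
Qed.

Let phi_axis n : phi n 0%N = axis_prob l n / (motzkin_count n 0)%:R.
Proof. by rewrite /phi v_axis. Qed.

(** The m(n, 0) paths to (n, 0) have probability 0 or phi(n, 0), and their total
    is m(n, 0) phi(n, 0): none of them can have probability 0. *)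
Let nu_cyl_axis n (w : motzkin_path) : w n = 0%N ->
  nu (prefix_cyl n w) = (phi n 0)%:E.
Proof.
move=> wn; case: (dichotomy n w); last by rewrite wn.
move=> nu0; rewrite nu0; congr (_%:E); apply/esym.
have := nu_axis n; rewrite -[passes n 0]setIT measure_passesI //.
have phi_ge0 : 0 <= phi n 0.
  rewrite /phi -nu_axis divr_ge0 // fine_ge0 //.
rewrite (eq_bigr (fun p => (fine (nu (cylinder p)))%:E)); last first.
  move=> p /motzkin_toP[u -> _]; rewrite setIT cylinder_history fineK //.
  by apply: fin; exact: measurable_prefix_cyl.
rewrite sumEFin /= => e.
have : \sum_(p in motzkin_to n 0) (phi n 0 - fine (nu (cylinder p))) = 0.
  rewrite sumrB e sumr_const -/(motzkin_count n 0) /phi -[_ *+ _]mulr_natr.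
  by rewrite divfK ?subrr // m0.
move/eqP; rewrite psumr_eq0 => [/allP/(_ (history n w))|p].
  rewrite mem_index_enum => /(_ isT); rewrite -wn history_motzkin wn /=.
  by rewrite cylinder_history nu0 /= subr0 => /eqP.
move=> /motzkin_toP[u -> un]; rewrite cylinder_history subr_ge0.
by case: (dichotomy n u) => ->; rewrite //= un.
Qed.

Let t := 1 - l.1 - l.2.

Let axis1 : axis_prob l 1 = t.
Proof.
rewrite /axis_prob big_ord1 /= muln0 subn0 expr1 !expr0 /factorial /=.
by rewrite -/t; field.
Qed.

Let axis2 : axis_prob l 2 = t ^+ 2 + l.1 * l.2.
Proof.
rewrite /axis_prob big_ord_recr big_ord1 /= -/t /factorial /=.
by field.
Qed.

Let axis3 : axis_prob l 3 = t ^+ 3 + 3 * t * (l.1 * l.2).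
Proof.
rewrite /axis_prob big_ord_recr big_ord1 /= -/t /factorial /=.
by field.
Qed.

Let count1 : motzkin_count 1 0 = 1%N.
Proof. by rewrite motzkin_countS !motzkin_count0. Qed.

Let count2 : motzkin_count 2 0 = 2%N.
Proof. by rewrite !motzkin_countS !motzkin_count0. Qed.

Let count3 : motzkin_count 3 0 = 4%N.
Proof. by rewrite !motzkin_countS !motzkin_count0. Qed.

Let l1_ge0 : 0 <= l.1. Proof. by case: hl => /andP[]. Qed.
Let l2_ge0 : 0 <= l.2. Proof. by case: hl => _ /andP[]. Qed.
Let t_ge0 : 0 <= t. Proof. by case: hl => _ _ _ /andP[]; rewrite /t; lra. Qed.

(** When t > 0 all axis probabilities are positive.  A path can be continued to
    the axis, and the continuation has positive probability, so the path has. *)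
Lemma is_M_density_pos : 0 < t -> cyl_density nu phi.
Proof.
move=> t_gt0 n w; case: (dichotomy n w) => // nu0.
have [u [uw u0]] := path_to_axis w n.
have : (nu (prefix_cyl (n + w n) u) <= nu (prefix_cyl n w))%E.
  apply: le_measure; rewrite ?inE //; try exact: measurable_prefix_cyl.
  exact: prefix_cyl_sub (leq_addr _ _) uw.
rewrite nu0 nu_cyl_axis // lee_fin leNgt => /negP[].
rewrite phi_axis divr_gt0 //; last by rewrite ltr0n motzkin_count_gt0.
rewrite /axis_prob big_ord_recl /= muln0 subn0 !expr0 !mulr1.
apply: ltr_pwDl.
  by rewrite mulr_gt0 ?exprn_gt0 // divr_gt0 // ltr0n ?muln_gt0 ?fact_gt0.
apply: sumr_ge0 => k _.
by rewrite !mulr_ge0 ?invr_ge0 ?exprn_ge0.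
Qed.

(** Write q = l1 l2.  If t > 0, the first four axis values are 1, t, (t^2 + q) / 2
    and (t^3 + 3 t q) / 4; the moment inequalities give t^2 <= q and then
    q <= t^2.  If t = 0 < q, two flat steps have positive probability although
    one flat step has probability 0. *)
Lemma is_M_product : l.1 * l.2 = t ^+ 2.
Proof.
have q0 : 0 <= l.1 * l.2 by rewrite mulr_ge0.
move: t_ge0; rewrite le_eqVlt => /orP[/eqP t0|t_gt0].
  rewrite -t0 expr0n /=; apply/eqP; rewrite eq_le q0 andbT leNgt.
  apply/negP => q_gt0.
  have flat : (nu (prefix_cyl 2 (level_path 0)) <= nu (prefix_cyl 1 (level_path 0)))%E.
    apply: le_measure; rewrite ?inE //; try exact: measurable_prefix_cyl.
    exact: prefix_cyl_sub.
  move: flat; rewrite !nu_cyl_axis ?minn0 //= lee_fin !phi_axis axis1 axis2.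
  rewrite count1 count2 -t0 expr0n /= mul0r add0r leNgt => /negP; apply.
  by rewrite divr_gt0.
have nu_phi := is_M_density_pos t_gt0.
have q1 : t ^+ 2 <= l.1 * l.2.
  have := moment_quadratic 0 nu_phi t_ge0.
  rewrite !phi_axis axis0 axis1 axis2 count1 count2 motzkin_count0 /=.
  by rewrite !divr1; lra.
have q_gt0 : 0 < l.1 * l.2 by apply: lt_le_trans q1; rewrite exprn_gt0.
(* The ratio c_2 / c_1 of axis values, at which c_3 - 2 s c_2 + s^2 c_1 is
   minimal. *)
pose s := (t ^+ 2 + l.1 * l.2) / (2 * t).
have s0 : 0 <= s by rewrite divr_ge0 ?addr_ge0 ?mulr_ge0 ?sqr_ge0.
have := moment_quadratic 1 nu_phi s0.
rewrite !phi_axis axis1 axis2 axis3 count1 count2 count3 /=.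
move: q0 q1 q_gt0; rewrite /s; move: (l.1 * l.2) => q q0 q1 q_gt0 h.
have {}h : (t ^+ 2 + q) ^+ 2 <= t ^+ 4 + 3 * t ^+ 2 * q.
  have e1 : 2 * ((t ^+ 2 + q) / (2 * t)) * ((t ^+ 2 + q) / 2%:R) * (2 * t)
      = (t ^+ 2 + q) ^+ 2 by field; rewrite gt_eqF.
  have e2 : ((t ^+ 3 + 3 * t * q) / 4%:R
      + ((t ^+ 2 + q) / (2 * t)) ^+ 2 * (t / 1%:R)) * (2 * t)
      = (t ^+ 4 + 3 * t ^+ 2 * q) / 2 + (t ^+ 2 + q) ^+ 2 / 2.
    by field; rewrite gt_eqF.
  have := h; rewrite -(@ler_pM2r _ (2 * t)) ?mulr_gt0 // e1 e2; lra.
apply/eqP; rewrite eq_le q1 andbT -(ler_pM2l q_gt0).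
by move: h; rewrite !exprS expr0; lra.
Qed.

Let phi_power n d : (d <= n)%N -> phi n d = power_density t n d.
Proof.
move=> dn; rewrite harmonic_axis //; apply: eq_axis_extension => k.
by rewrite phi_axis axis_prob_diag ?is_M_product // mulrAC mulfV ?mul1r // m0.
Qed.

(** In the remaining case t = 0 the candidate density is nonnegative.  The continuations
    of a path by one step have probabilities at most their densities, with equal
    sums, so the probabilities and densities agree. *)
Lemma is_M_density : cyl_density nu (power_density t).
Proof.
move=> n w; rewrite -phi_power ?height_le //; move: n w.
move: t_ge0; rewrite le_eqVlt => /orP[/eqP t0|]; last exact: is_M_density_pos.
have pos n d : (d <= n)%N -> 0 <= phi n d.
  move=> dn; rewrite phi_power // /power_density.
  suff -> : axis_extension (fun k => t ^+ k) d n = (d == n)%:R by [].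
  rewrite -t0; elim/ltn_ind: d n dn => -[|[|d]] IHd [|n] dn //.
  - by rewrite /= expr0n.
  - by rewrite /= !expr0n /= subr0 eqSS eq_sym.
  rewrite axis_extensionSS -[n.+1.-1]/n (IHd d.+1) // (IHd d.+1) //; last exact: ltnW.
  rewrite (IHd d) //; last by apply: ltnW; exact: ltnW.
  have dn' : (d < n)%N by rewrite -ltnS.
  by rewrite !eqSS (ltn_eqF dn') (ltn_eqF (leqW dn' : (d < n.+1)%N)) !subr0.
move=> n w; elim: n => [|n IHn].
  rewrite prefix_cyl0 probability_setT phi_power ?height_le // height_root.
  by rewrite /power_density /= expr0.
have mE d : measurable (prefix_cyl n w `&` passes n.+1 d).
  by apply: measurableI; [exact: measurable_prefix_cyl|exact: measurable_passes].
pose X d := fine (nu (prefix_cyl n w `&` passes n.+1 d)).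
have leX d : motzkin_step (w n) d -> X d <= phi n.+1 d.
  move=> h; have dn : (d <= n.+1)%N.
    by case/andP: h => _ h; apply: leq_trans h _; rewrite ltnS height_le.
  rewrite /X -prefix_cylS; case: (dichotomy n.+1 (turn h)) => -> /=.
    exact: pos.
  by rewrite ltnn.
have XE d : nu (prefix_cyl n w `&` passes n.+1 d) = (X d)%:E.
  by rewrite /X fineK //; exact: fin.
have split : (phi n (w n))%:E = (at_pred (fun d => (X d)%:E) (w n)
    + (X (w n))%:E + (X (w n).+1)%:E)%E.
  rewrite -IHn -!XE; have := measure_split_next nu n w (@measurableT _ _).
  rewrite ![_ `&` setT]setIT => h; apply: etrans h _; congr (_ + _ + _)%E.
  by case: (w n) => //= d; rewrite setIT -XE.
move: split; rewrite (hphi (height_le w n)).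
have -> : prefix_cyl n.+1 w = prefix_cyl n w `&` passes n.+1 (w n.+1).
  apply/seteqP; split=> [u uw|u [un uw] i].
    split; last exact: uw.
    by move=> i lein; rewrite uw // leqW.
  by rewrite leq_eqVlt ltnS => /orP[/eqP -> //|]; exact: un.
have := height_step w n; rewrite !XE => stw.
have le0 := leX _ (motzkin_step_refl (w n)).
have le1 := leX _ (motzkin_step_up (w n)).
move: stw leX le0 le1; case: (w n) => [|d] /= stw leX le0 le1.
  rewrite !add0r -!EFinD => -[] e.
  have [->|->] : w n.+1 = 0%N \/ w n.+1 = 1%N.
  - by move: stw; rewrite /motzkin_step; lia.
  - by congr (_%:E); lra.
  - by congr (_%:E); lra.
have le2 := leX _ (motzkin_step_down d).
rewrite -!EFinD => -[] e.
have [->|[->|->]] : w n.+1 = d \/ w n.+1 = d.+1 \/ w n.+1 = d.+2.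
- by move: stw; rewrite /motzkin_step; lia.
- by congr (_%:E); lra.
- by congr (_%:E); lra.
- by congr (_%:E); lra.
Qed.

End is_M_facts.

(** * A random path with a given harmonic density *)

Section interval_construction.
Context {R : realType}.
Variable phi : nat -> nat -> R.
Hypothesis hphi : path_harmonic phi.
Hypothesis phi_ge0 : forall n d, (d <= n)%N -> 0 <= phi n d.

(** Every finite path w owns an interval of length phi(n, w n), cut into three
    consecutive intervals for the continuations down, flat and up.  For u in the
    initial interval, [locate u n] is the height at time n of the path whose
    interval contains u, with the left end of that interval. *)
Fixpoint locate (u : R) (n : nat) : nat * R :=
  if n is n1.+1 then
    let: (d, a) := locate u n1 in
    let a1 := a + at_pred (phi n) d in
    let a2 := a1 + phi n d in
    if u < a1 then (d.-1, a) else if u < a2 then (d, a1) else (d.+1, a2)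
  else (0%N, 0).

Lemma locate_step u n : motzkin_step (locate u n).1 (locate u n.+1).1.
Proof.
rewrite /=; case: (locate u n) => d a /=; rewrite /motzkin_step.
by case: ifP => _ /=; [|case: ifP => _ /=]; lia.
Qed.

Definition located_path u : motzkin_path :=
  MotzkinPath (height := fun n => (locate u n).1) erefl (locate_step u).

Fixpoint left_end (w : nat -> nat) (n : nat) : R :=
  if n is n1.+1 then
    let a := left_end w n1 in
    let a1 := a + at_pred (phi n) (w n1) in
    if (w n < w n1)%N then a else if w n == w n1 then a1
    else a1 + phi n (w n1)
  else 0.

Let inside (w : nat -> nat) n u :=
  left_end w n <= u < left_end w n + phi n (w n).

(** The two parts are proved together: the second one tells which comparison with
    u decides the next step in the first one. *)
Lemma inside_locate (w : motzkin_path) n u : 0 <= u < phi 0 0 ->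
  (prefix_cyl n w (located_path u) <-> inside w n u) /\
  (inside w n u -> locate u n = (w n, left_end w n)).
Proof.
move=> u01; elim: n => [|n [IH1 IH2]].
  rewrite prefix_cyl0 /inside /= height_root add0r u01; split=> //.
have cylS : prefix_cyl n.+1 w (located_path u) <->
    inside w n u /\ (locate u n.+1).1 = w n.+1.
  split=> [h|[/IH1 h un] i].
    split; last exact: (h n.+1).
    by apply/IH1 => i lein; apply: h; rewrite leqW.
  by rewrite leq_eqVlt ltnS => /orP[/eqP -> //|]; exact: h.
have wn := height_le w n.
have st := height_step w n.
have h0 : 0 <= at_pred (phi n.+1) (w n).
  by case: (w n) wn => [//|d] dn /=; apply: phi_ge0; lia.
have h1 : 0 <= phi n.+1 (w n) by apply: phi_ge0; rewrite leqW.
have h2 : 0 <= phi n.+1 (w n).+1 by exact: phi_ge0.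
have hE := hphi wn.
pose a := left_end w n; pose P := at_pred (phi n.+1) (w n).
have insideE : inside w n u = (a <= u < a + (P + phi n.+1 (w n)
    + phi n.+1 (w n).+1)) by rewrite /inside hE.
have loc : inside w n u -> locate u n.+1 =
    if u < a + P then ((w n).-1, a) else
    if u < a + P + phi n.+1 (w n) then (w n, a + P)
    else ((w n).+1, a + P + phi n.+1 (w n)).
  by move=> /IH2 /= ->.
have main : (inside w n.+1 u <-> inside w n u /\ (locate u n.+1).1 = w n.+1) /\
    (inside w n.+1 u -> locate u n.+1 = (w n.+1, left_end w n.+1)); last first.
  case: main => m1 m2; split => //.
  by split=> [/cylS/m1|/m1/cylS].
have [[d0 e]|[e|e]] : ((0 < w n)%N /\ w n.+1 = (w n).-1) \/
    w n.+1 = w n \/ w n.+1 = (w n).+1.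
- move: st; rewrite /motzkin_step; move: (w n) (w n.+1) => x y; clear; lia.
- have PE : P = phi n.+1 (w n.+1) by rewrite /P e; case: (w n) d0.
  have lE : left_end w n.+1 = a by rewrite /= e ifT //; lia.
  have inE : inside w n.+1 u = (a <= u < a + P) by rewrite /inside lE PE.
  have imp : inside w n.+1 u -> inside w n u.
    rewrite inE insideE -/P in h0 * => /andP[-> /=] h; clear -h h1 h2; lra.
  split; last first.
    by move=> i1; rewrite loc ?imp // lE e; move: i1; rewrite inE => /andP[_ ->].
  split=> [i1|[i0]].
    by split; rewrite ?loc ?imp // e; move: i1; rewrite inE => /andP[_ ->].
  rewrite loc // e inE; move: i0; rewrite insideE => /andP[-> _] /=.
  by case: ifP => // _; case: ifP => _ /=; clear -d0; lia.
- have lE : left_end w n.+1 = a + P by rewrite /= e ltnn eqxx.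
  have inE : inside w n.+1 u = (a + P <= u < a + P + phi n.+1 (w n)).
    by rewrite /inside lE e.
  have imp : inside w n.+1 u -> inside w n u.
    rewrite inE insideE -/P in h0 * => /andP[h h']; apply/andP.
    by clear -h h' h0 h1 h2; split; lra.
  split; last first.
    move=> i1; rewrite loc ?imp // lE e; move: i1; rewrite inE => /andP[h ->].
    by rewrite ltNge h.
  split=> [i1|[i0]].
    split; rewrite ?loc ?imp // e; move: i1; rewrite inE => /andP[h ->].
    by rewrite ltNge h.
  rewrite loc // e inE; move: i0; rewrite insideE => /andP[au _] /=.
  case: ltP => [h|h /=].
    rewrite /= => dd; exfalso; move: h; rewrite /P.
    have -> : w n = 0%N by move: dd; clear; lia.
    by rewrite /= addr0 ltNge au.
  by case: ifP => // _ /=; clear; lia.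
- have lE : left_end w n.+1 = a + P + phi n.+1 (w n).
    by rewrite /= e ltnNge leqnSn /= gtn_eqF.
  have inE : inside w n.+1 u = (a + P + phi n.+1 (w n) <= u
      < a + P + phi n.+1 (w n) + phi n.+1 (w n).+1).
    by rewrite /inside lE e.
  have imp : inside w n.+1 u -> inside w n u.
    rewrite inE insideE -/P in h0 * => /andP[h h']; apply/andP.
    by clear -h h' h0 h1 h2; split; lra.
  have hP : inside w n.+1 u -> (u < a + P) = false.
    rewrite inE -/P in h0 * => /andP[h _]; apply/negbTE; rewrite -leNgt.
    by clear -h h1; lra.
  split; last first.
    move=> i1; rewrite loc ?imp // lE e hP //; move: i1; rewrite inE => /andP[h _].
    by rewrite ltNge h.
  split=> [i1|[i0]].
    split; rewrite ?loc ?imp // e hP //; move: i1; rewrite inE => /andP[h _].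
    by rewrite ltNge h.
  rewrite loc // e inE; move: i0; rewrite insideE => /andP[au h'] /=.
  case: ltP => [_ /=|_]; first by clear; lia.
  case: ltP => [_ /=|_ _ /=]; first by clear; lia.
  by clear -h'; lra.
Qed.

Lemma left_end_bounds (w : motzkin_path) n :
  0 <= left_end w n /\ left_end w n + phi n (w n) <= phi 0 0.
Proof.
elim: n => [|n [IH1 IH2]]; first by rewrite /= add0r height_root.
have wn := height_le w n.
have st := height_step w n.
have h0 : 0 <= at_pred (phi n.+1) (w n).
  by case: (w n) wn => [//|d] dn /=; apply: phi_ge0; lia.
have h1 : 0 <= phi n.+1 (w n) by apply: phi_ge0; rewrite leqW.
have h2 : 0 <= phi n.+1 (w n).+1 by exact: phi_ge0.
have hE := hphi wn.
have [[d0 e]|[e|e]] : ((0 < w n)%N /\ w n.+1 = (w n).-1) \/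
    w n.+1 = w n \/ w n.+1 = (w n).+1.
- move: st; rewrite /motzkin_step; move: (w n) (w n.+1) => x y; clear; lia.
- have PE : at_pred (phi n.+1) (w n) = phi n.+1 (w n.+1).
    by rewrite e; case: (w n) d0.
  have lE : left_end w n.+1 = left_end w n by rewrite /= e ifT //; lia.
  rewrite PE in hE h0; rewrite lE.
  by clear -h0 h1 h2 hE IH1 IH2; split; lra.
- by rewrite /= e ltnn eqxx; clear -h0 h1 h2 hE IH1 IH2; split; lra.
- rewrite /= e ltnNge leqnSn /= gtn_eqF //.
  by clear -h0 h1 h2 hE IH1 IH2; split; lra.
Qed.

Definition unit_path (u : R) : motzkin_path :=
  if 0 <= u < 1 then located_path u else level_path 0.

Hypothesis phi1 : phi 0 0 = 1.

Let interval w n : set R :=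
  [set` `[left_end w n, left_end w n + phi n (w n)[ ].

Lemma unit_path_cyl (w : motzkin_path) n :
  [set` `[0, 1[ ] `&` [set u | prefix_cyl n w (unit_path u)] = interval w n.
Proof.
have [l0 l1] := left_end_bounds w n; rewrite phi1 in l1.
apply/seteqP; split=> u /=; rewrite !in_itv /=.
  move=> [u01]; rewrite /unit_path u01.
  have u01' : 0 <= u < phi 0 0 by rewrite phi1.
  by have [[h _] _] := inside_locate w n u01'; exact: h.
move=> iu; have u01 : 0 <= u < 1.
  case/andP: iu => h1 h2; apply/andP; split; first exact: le_trans l0 h1.
  exact: lt_le_trans h2 l1.
split=> //; rewrite /unit_path u01.
have u01' : 0 <= u < phi 0 0 by rewrite phi1.
by have [[_ h] _] := inside_locate w n u01'; exact: h.
Qed.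

Lemma measurable_unit_path : measurable_fun setT (unit_path : measurableTypeR R -> _).
Proof.
apply: measurable_to_paths => i a.
rewrite (_ : [set u | _] =
    (\bigcup_(p in [set` motzkin_to i a])
       ([set` `[0, 1[ ] `&` [set u | cylinder p (unit_path u)])) `|`
    (~` [set` `[0, 1[ ] `&` (if a == 0%N then setT else set0))).
  apply: measurableU.
    apply: fin_bigcup_measurable; first exact: finite_finset.
    move=> p /= /motzkin_toP[w -> _].
    by rewrite cylinder_history unit_path_cyl; exact: measurable_itv.
  apply: measurableI; first by apply: measurableC; exact: measurable_itv.
  by case: ifP => _; [exact: measurableT|exact: measurable0].
apply/seteqP; split=> u /=.
  have [u01|u01] := boolP (0 <= u < 1) => ua; [left|right].
    exists (history i (unit_path u)); first by rewrite /= -ua history_motzkin.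
    by rewrite /= in_itv /= u01 cylinder_history.
  split; first by rewrite in_itv; exact/negP.
  by rewrite /unit_path (negbTE u01) /= minn0 in ua; rewrite -ua.
move=> [[p /= /motzkin_toP[w -> <-] [_]]|[/negP u01]].
  by rewrite cylinder_history; apply.
rewrite in_itv /= in u01; rewrite /unit_path (negbTE u01) /= minn0.
by case: eqP.
Qed.

(** A uniform point of the unit interval falls into the interval of a finite path
    with probability its length. *)
Lemma exists_cyl_density : exists nu : probability motzkin_path R,
  cyl_density nu phi.
Proof.
have m01 : measurable ([set` `[0, 1[ ] : set (measurableTypeR R)) by exact: measurable_itv.
pose m : {measure set (measurableTypeR R) -> \bar R} := mrestr lebesgue_measure m01.
pose p : {measure set motzkin_path -> \bar R} := pushforward m unit_path.
have p_phi : cyl_density (p measurable_unit_path) phi.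
  move=> n w.
  have -> : p measurable_unit_path (prefix_cyl n w) =
      lebesgue_measure (interval w n) by rewrite -unit_path_cyl setIC.
  rewrite lebesgue_measure_itv /= lte_fin.
  have := phi_ge0 (height_le w n); rewrite le_eqVlt => /orP[/eqP <-|h].
    by rewrite addr0 ltxx.
  by rewrite ltrDl h -EFinB addrAC subrr add0r.
exists (mnormalize (p measurable_unit_path) (dirac (level_path 0))) => n w.
have mass : p measurable_unit_path setT = 1%E by rewrite (cyl_density_mass p_phi) phi1.
by rewrite -[LHS]/(mnormalize _ _ _) /mnormalize mass onee_eq0 /= invr1 mule1 p_phi.
Qed.

End interval_construction.

(** * Central measures as mixtures *)

Section mixture.
Context {R : realType}.

Definition admissible (t : R) :=
  forall n d, (d <= n)%N -> 0 <= power_density t n d.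

Lemma measurable_power_density n d :
  measurable_fun setT (fun t : measurableTypeR R => power_density t n d).
Proof. by apply: measurable_axis_extension => k; exact: measurable_funX. Qed.

Lemma measurable_admissible : measurable (admissible : set (measurableTypeR R)).
Proof.
rewrite (_ : admissible = \bigcap_n \bigcap_(d in [set d | (d <= n)%N])
    [set t | 0 <= power_density t n d]); last first.
  by apply/seteqP; split=> t h n; [move=> _ d dn; exact: h|move=> d dn; exact: h].
apply: bigcapT_measurable => n; rewrite bigcap_mkcond.
apply: bigcapT_measurable => d; case: ifP => // _.
rewrite (_ : [set t | _] = setT `&` (power_density ^~ n ^~ d) @^-1` `[0, +oo[%classic).
  by apply: measurable_power_density => //; exact: measurable_itv.
by rewrite setTI; apply/seteqP; split=> t /=; rewrite in_itv /= andbT.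
Qed.

Lemma power_density_harmonic (t : R) : path_harmonic (power_density t).
Proof. by move=> n d _; exact: axis_extensionE. Qed.

(** Outside the admissible parameters, which carry the mixture, a constant value
    keeps the family measurable in t. *)
Lemma admissible_law (nu0 : probability motzkin_path R) :
  exists M : R -> probability motzkin_path R,
    (forall t, admissible t -> cyl_density (M t) (power_density t)) /\
    (forall t, ~ admissible t -> M t = nu0).
Proof.
have [t|M hM] := @choice _ _ (fun (t : R) (nu : probability motzkin_path R) =>
  (admissible t -> cyl_density nu (power_density t)) /\
  (~ admissible t -> nu = nu0)).
  have [ht|ht] := pselect (admissible t); last by exists nu0.
  have [|nu hnu] := exists_cyl_density (@power_density_harmonic t) ht.
    by rewrite /power_density /= expr0.
  by exists nu.
by exists M; split => t ht; case: (hM t) => h1 h2; [exact: h1|exact: h2].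
Qed.

Variable nu : probability motzkin_path R.
Hypothesis nu_central : central nu.

Let fin : (nu setT < +oo)%E. Proof. by rewrite probability_setT ltry. Qed.
Let nu_end := central_end_determined nu_central.
Let T : motzkin_path -> R := flat_freq.

Let integrable_flat_freqX (mu : {measure set motzkin_path -> \bar R}) k :
  (mu setT < +oo)%E -> mu.-integrable setT (EFin \o (fun w => T w ^+ k)).
Proof.
move=> mufin; apply: measurable_bounded_integrable => //.
  by apply: measurable_funX; exact: measurable_flat_freq.
exists 1; split=> // M M1 w _ /=.
have /andP[T0 T1] := @flat_freq_itv R w.
by rewrite ger0_norm ?exprn_ge0 // (le_trans (exprn_ile1 _ T0 T1)) // ltW.
Qed.

(** By linearity of the extension, from the moments of the frequency. *)
Lemma integral_power_density (mu : {measure set motzkin_path -> \bar R}) n d :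
  (mu setT < +oo)%E -> end_determined mu -> (d <= n)%N ->
  mu.-integrable setT (fun w => (power_density (T w) n d)%:E) /\
  (\int[mu]_w (power_density (T w) n d)%:E = (density mu n d)%:E)%E.
Proof.
move=> mufin muE dn; have mu_psi := end_determined_density mufin muE.
have [i ->] := @integral_axis_extension _ _ motzkin_path mu (fun k w => T w ^+ k)
  (fun k => density mu k 0) d n (fun k => integrable_flat_freqX k mufin)
  (fun k => integral_flat_freqX mu_psi k).
by split=> //; rewrite [in RHS](harmonic_axis (cyl_density_harmonic mu_psi)).
Qed.

(** Restrict nu to the tail event A where the density at (n, d) is negative.  The
    restriction is end-determined, so the integral of that density over A is the
    probability of a cylinder within A, which is nonnegative: A is negligible. *)
Lemma flat_freq_admissible : {ae nu, forall w, admissible (T w)}.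
Proof.
suff h n d : {ae nu, forall w, (d <= n)%N -> 0 <= power_density (T w) n d}.
  have : {ae nu, forall w, forall n d, (d <= n)%N -> 0 <= power_density (T w) n d}.
    by apply: ae_foralln => n; apply: ae_foralln => d; exact: h.
  exact.
have [dn|nd] := leqP d n; last by apply: aeW => w.
pose h w := power_density (T w) n d.
have mh : measurable_fun setT h.
  exact: (measurableT_comp (measurable_power_density n d) measurable_flat_freq).
pose A := [set w | h w < 0].
have mA : measurable A.
  rewrite (_ : A = setT `&` h @^-1` `]-oo, 0[%classic).
    by apply: mh => //; exact: measurable_itv.
  by rewrite setTI; apply/seteqP; split=> t /=; rewrite in_itv.
have tA : tail_invariant A.
  exact: (flat_freq_tail_invariant (B := [set t | power_density t n d < 0])).
pose nuA : {measure set motzkin_path -> \bar R} := mrestr nu mA.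
have nuAE : end_determined nuA := end_determined_tail fin nu_end mA tA.
have finA : (nuA setT < +oo)%E.
  apply: le_lt_trans fin; rewrite /nuA /= /mrestr setTI.
  by apply: le_measure; rewrite ?inE.
have [hint ih] := integral_power_density finA nuAE dn.
have nuA_A : {ae nuA, forall w, A w}.
  exists (~` A); split => //; first exact: measurableC.
  by rewrite /nuA /= /mrestr setICl measure0.
have mhE : measurable_fun setT (fun w => (h w)%:E) by exact/measurable_EFinP.
have Ih : (\int[nuA]_w `|(h w)%:E| = 0)%E.
  apply/eqP; rewrite eq_le integral_ge0 // andbT.
  rewrite (ae_eq_integral (fun w => - (h w)%:E)%E) //; last 3 first.
  - exact: measurableT_comp.
  - exact: measurableT_comp.
  - by apply: filterS nuA_A => w Aw _; rewrite lte0_abs // lte_fin.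
  rewrite integralN /=; last exact: integrable_add_def hint.
  by rewrite ih leeNl oppe0 lee_fin fine_ge0.
have h0 := (ae_eq_integral_abs nuA measurableT mhE).1 Ih.
have : nu A = 0%E.
  have [N [mN N0 sN]] := h0.
  apply/eqP; rewrite eq_le measure_ge0 andbT -[leRHS]N0 /nuA /= /mrestr.
  apply: le_measure; rewrite ?inE //; first exact: measurableI.
  move=> w Aw; split => //; apply: sN => /(_ I) /= [] h00.
  by move: Aw; rewrite /A /= h00 ltxx.
move=> A0; exists A; split=> // w /= hw; rewrite /A /= ltNge; apply/negP => h'.
exact: hw.
Qed.

(** On cylinders the integral is that of [integral_power_density]; both properties
    are stable under complements and disjoint countable unions. *)
Lemma measurable_law_eval (M : R -> probability motzkin_path R) :
  (forall t, admissible t -> cyl_density (M t) (power_density t)) ->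
  (forall t, ~ admissible t -> M t = nu) ->
  forall B, measurable B ->
  measurable_fun setT (fun t : measurableTypeR R => M t B) /\
  nu B = (\int[nu]_w M (T w) B)%E.
Proof.
move=> M_adm M_def.
have mT : measurable_fun setT (T : _ -> measurableTypeR R) := measurable_flat_freq.
have mcyl n (w : motzkin_path) :
    measurable_fun setT (fun t : measurableTypeR R => M t (prefix_cyl n w)).
  rewrite (_ : (fun t => _) = (fun t =>
    (if t \in (admissible : set R) then (power_density t n (w n))%:E
     else nu (prefix_cyl n w)))).
    apply: measurable_fun_ifT => //.
    - apply: (measurable_fun_bool true).
      by rewrite setTI preimage_mem_true; exact: measurable_admissible.
    - by apply/measurable_EFinP; exact: measurable_power_density.
  apply/funext => t; case: ifPn => [/set_mem|/negP] ht.
    by rewrite M_adm.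
  by rewrite M_def // => h; apply: ht; exact/mem_set.
apply: cylinder_induction.
- move=> n w; split; first exact: mcyl.
  rewrite (ae_eq_integral (fun w' => (power_density (T w') n (w n))%:E)) //.
  + have [_ ->] := integral_power_density fin nu_end (height_le w n).
    exact: end_determined_density.
  + exact: measurableT_comp (mcyl n w) mT.
  + apply/measurable_EFinP.
    exact: (measurableT_comp (measurable_power_density n (w n)) mT).
  + by apply: filterS flat_freq_admissible => u hu _; rewrite M_adm.
- split; first by under eq_fun do rewrite measure0; exact: measurable_cst.
  by under eq_integral do rewrite measure0; rewrite integral0 measure0.
- move=> S mS [mMS eS]; have mMTS := measurableT_comp mMS mT.
  have mMC : measurable_fun setT (fun t : measurableTypeR R => M t (~` S)).
    under eq_fun do rewrite probability_setC //.
    exact: emeasurable_funB.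
  split=> //; rewrite probability_setC //.
  have : (\int[nu]_w (M (T w) (~` S) + M (T w) S) = 1)%E.
    rewrite (eq_integral (cst 1%E)).
      by rewrite integral_cst // mul1e; exact: probability_setT.
    move=> w _; rewrite probability_setC // subeK // fin_num_measure //.
  rewrite ge0_integralD //; last exact: measurableT_comp mMC mT.
  rewrite -eS => <-; rewrite addeK // fin_num_measure //.
- move=> F mF tF hF.
  have mU : measurable (\bigcup_k F k) by exact: bigcupT_measurable.
  have UE (m : probability motzkin_path R) :
      m (\bigcup_k F k) = (\sum_(k <oo) m (F k))%E.
    exact: measure_semi_bigcup.
  split.
    under eq_fun do rewrite UE.
    apply: ge0_emeasurable_sum => //.
    by move=> k _; case: (hF k).
  rewrite UE; under eq_integral do rewrite UE.
  rewrite integral_nneseries //.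
    by apply: eq_eseriesr => k _; case: (hF k).
  by move=> k; case: (hF k) => mFk _; exact: measurableT_comp mFk mT.
Qed.

Lemma measurable_param_of :
  measurable_fun setT (param_of : measurableTypeR R ->
    measurableTypeR R * measurableTypeR R).
Proof.
have ms : measurable_fun setT (fun t : measurableTypeR R =>
    Num.sqrt ((1 - 3 * t) * (1 + t))).
  apply: measurableT_comp.
    by apply: continuous_measurable_fun; exact: sqrt_continuous.
  apply: measurable_funM; last exact: measurable_funD.
  by apply: measurable_funB => //; exact: measurable_funM.
have m1 : measurable_fun setT (fun t : measurableTypeR R => 1 - t).
  exact: measurable_funB.
apply: measurable_fun_pair; apply: measurable_funM => //.
  exact: measurable_funD.
exact: measurable_funB.
Qed.

Let mfst : measurable_fun setT (fun l : measurableTypeR R * measurableTypeR R => l.1).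
Proof. exact: measurable_fst. Qed.

Let msnd : measurable_fun setT (fun l : measurableTypeR R * measurableTypeR R => l.2).
Proof. exact: measurable_snd. Qed.

Lemma param_setE (x y : R) : param_set (x, y) <->
  [/\ 0 <= x, 0 <= y, 0 <= x - y & 0 <= 1 - x - y].
Proof.
split=> [[/= /andP[? ?] /andP[? ?] ? /andP[? ?]]|[? ? ? ?]].
  by split; lra.
by split => /=; try (apply/andP; split); lra.
Qed.

Lemma measurable_param_set : measurable (@param_set R).
Proof.
have half (f : measurableTypeR R * measurableTypeR R -> R) :
    measurable_fun setT f -> measurable [set l | 0 <= f l].
  move=> mf; rewrite (_ : [set l | _] = setT `&` f @^-1` `[0, +oo[%classic).
    by apply: mf => //; exact: measurable_itv.
  by rewrite setTI; apply/seteqP; split=> l /=; rewrite in_itv /= andbT.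
have m1 := half _ mfst.
have m2 := half _ msnd.
have m3 := half _ (measurable_funB mfst msnd).
have m4 : measurable [set l : measurableTypeR R * measurableTypeR R | 0 <= 1 - l.1 - l.2].
  by apply: half; apply: measurable_funB => //; exact: measurable_funB.
rewrite (_ : param_set = [set l | 0 <= l.1] `&` [set l | 0 <= l.2] `&`
    [set l | 0 <= l.1 - l.2] `&` [set l | 0 <= 1 - l.1 - l.2]).
  by do 3 (apply: measurableI => //).
apply/seteqP; split=> -[x y]; first by move=> /param_setE[? ? ? ?]; do !split.
by move=> [[[? ?] ?] ?]; exact/param_setE.
Qed.

(** The mixing measure is the law of [param_of T], T being the frequency of flat
    steps.  The chain attached to a point l of the plane only depends on its flat
    weight 1 - l1 - l2, which recovers T from [param_of T]. *)
Lemma central_mixture :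
  exists mu : probability (measurableTypeR R * measurableTypeR R)%type R,
    mu param_set = 1%E /\ is_M_mixture mu nu.
Proof.
have [M [M_adm M_def]] := admissible_law nu.
have mM := measurable_law_eval M_adm M_def.
have mT : measurable_fun setT (T : _ -> measurableTypeR R) := measurable_flat_freq.
pose X : motzkin_path -> (measurableTypeR R * measurableTypeR R)%type :=
  param_of \o T.
have mX : measurable_fun setT X.
  exact: measurableT_comp measurable_param_of mT.
pose X' : {mfun motzkin_path >-> (measurableTypeR R * measurableTypeR R)%type} :=
  mfun_Sub (mem_set mX).
pose mu : probability (measurableTypeR R * measurableTypeR R)%type R :=
  distribution nu X'.
have muE A : mu A = nu (X @^-1` A) by [].
pose flat (l : measurableTypeR R * measurableTypeR R) : measurableTypeR R := 1 - l.1 - l.2.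
have mflat : measurable_fun setT flat.
  by apply: measurable_funB => //; exact: measurable_funB.
have XT w : flat (X w) = T w by exact: param_of_flat.
have T0 w : 0 <= T w by case/andP: (@flat_freq_itv R w).
pose good := [set l : measurableTypeR R * measurableTypeR R |
  admissible (flat l) /\ l.1 * l.2 = flat l ^+ 2].
have good_of w : admissible (T w) -> good (X w) /\ param_set (X w).
  move=> hw; have T3 := power_density_ge0_le (T0 w) hw.
  split; last exact: param_set_param_of.
  by split; rewrite ?XT // /X /=; exact: param_of_product.
have mgood : measurable good.
  rewrite (_ : good = (setT `&` flat @^-1` admissible) `&`
      (setT `&` (fun l => l.1 * l.2 - flat l ^+ 2) @^-1` [set 0])).
    apply: measurableI.
      by apply: mflat => //; exact: measurable_admissible.
    have : measurable_fun setT (fun l : measurableTypeR R * measurableTypeR R =>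
        l.1 * l.2 - flat l ^+ 2).
      by apply: measurable_funB; [exact: measurable_funM|exact: measurable_funX].
    by apply => //; exact: measurable_set1.
  rewrite !setTI; apply/seteqP; split=> l /= [? h]; split => //.
    by rewrite h subrr.
  by apply/eqP; rewrite -subr_eq0; exact/eqP.
have null B : measurable B -> (forall w, admissible (T w) -> ~ B (X w)) ->
    mu B = 0%E.
  move=> mB hB; rewrite muE.
  have mXB : measurable (X @^-1` B) by rewrite -[Y in measurable Y]setTI; exact: (mX measurableT B mB).
  have [N [mN N0 sN]] := flat_freq_admissible.
  apply/eqP; rewrite eq_le measure_ge0 andbT -N0.
  apply: le_measure; rewrite ?inE // => w hw; apply: sN => /= h.
  exact: hB h hw.
have mparam := measurable_param_set.
have muparam : mu (~` param_set) = 0%E.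
  apply: null; first exact: measurableC.
  by move=> w /good_of[_ hw]; apply.
exists mu; split.
  by rewrite -[param_set]setCK probability_setC ?muparam ?sube0 //; exact: measurableC.
exists (fun l => M (flat l)); split.
- exists (~` good); split.
  + exact: measurableC.
  + by apply: null; [exact: measurableC|move=> w /good_of[hw _]; apply].
  move=> l /= h [adm prod]; apply: h => _.
  exact: power_density_is_M (M_adm _ adm).
- move=> A mA; apply: measurable_funTS.
  exact: measurableT_comp (mM A mA).1 mflat.
move=> A mA; rewrite (mM A mA).2.
have mMA : measurable_fun setT (fun l => M (flat l) A).
  exact: measurableT_comp (mM A mA).1 mflat.
transitivity (\int[mu]_l M (flat l) A)%E.
  rewrite ge0_integral_pushforward //.
  by rewrite preimage_setT; apply: eq_integral => w _; rewrite /= XT.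
rewrite (ge0_negligible_integral (measurableC mparam)) //.
by rewrite setTD setCK.
Qed.

End mixture.

Theorem theorem4p11 (R : realType) :
  (forall nu : probability motzkin_path R,
     (central nu /\ ergodic nu) <->
     (exists l : R * R, param_set l /\ is_M l nu)) /\
  (forall nu : probability motzkin_path R, central nu ->
     exists mu : probability (measurableTypeR R * measurableTypeR R)%type R,
       mu param_set = 1%E /\ is_M_mixture mu nu).
Proof.
split; last exact: central_mixture.
move=> nu; split=> [[cnu enu]|[l [hl [v [v_axis v_rec nu_axis mk tr]]]]].
  have [t [t0 nu_t]] := ergodic_power_density cnu enu.
  have t3 : 3 * t <= 1.
    apply: power_density_ge0_le t0 _ => n d dn.
    by rewrite -lee_fin -(level_path_end dn) -nu_t.
  exists (param_of t); split; first exact: param_set_param_of.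
  by apply: power_density_is_M; rewrite param_of_flat // param_of_product.
have nu_t := is_M_density hl v_axis v_rec nu_axis mk tr.
split; first exact: cyl_density_central nu_t.
exact: power_density_ergodic nu_t.
Qed.
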